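(* Let $G$ be a discrete group and let $-\rtimes_\mu G$ be a correspondence crossed product functor. Then the coproduct $\Delta\colon\mathbb{C}G\to\mathbb{C}G\odot\mathbb{C}G$, $\sum a_g\,g\mapsto\sum a_g\,(g\otimes g)$, extends continuously to a *-homomorphism \[\Delta\colon C^*_\mu G\to C^*_{\max}G\otimes_\mu C^*_\mu G.\]
   Context: Let $G$ be a discrete group. A $G$-C*-algebra is a C*-algebra $A$ with an action $\alpha\colon G\to\operatorname{Aut}(A)$. Let $A\rtimes_{\mathrm{alg}}G=C_c(G,A)$ with product $(f*g)(t)=\sum_{s}f(s)\alpha_s(g(s^{-1}t))$ and involution $f^*(s)=\alpha_s(f(s^{-1})^* )$; a $G$-equivariant *-homomorphism $\varphi\colon A\to B$ induces $f\mapsto\varphi\circ f$. Let $-\rtimes_{\max}G$ and $-\rtimes_rG$ be the maximal and reduced crossed product functors; each contains $A\rtimes_{\mathrm{alg}}G$ as a dense *-subalgebra, and $\Lambda\colon -\rtimes_{\max}G\to-\rtimes_rG$ is the canonical natural surjection. A crossed product functor $-\rtimes_\mu G$ is a functor from $G$-C*-algebras (with $G$-equivariant *-homomorphisms) to C*-algebras (with *-homomorphisms) together with natural transformations $q\colon-\rtimes_{\max}G\to-\rtimes_\mu G$ and $s\colon-\rtimes_\mu G\to-\rtimes_rG$ consisting of surjective *-homomorphisms with $s\circ q=\Lambda$; thus $A\rtimes_{\mathrm{alg}}G$ is a dense *-subalgebra of $A\rtimes_\mu G$. Put $C^*_\mu G:=\mathbb{C}\rtimes_\mu G$, a completion of $\mathbb{C}G$,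 and $C^*_{\max}G:=\mathbb{C}\rtimes_{\max}G$. The functor is a correspondence crossed product functor (equivalently, has the cp-map property) if for every $G$-equivariant completely positive map $\varphi\colon A\to B$ of $G$-C*-algebras there is a completely positive map $\varphi\rtimes_\mu G\colon A\rtimes_\mu G\to B\rtimes_\mu G$ with $(\varphi\rtimes_\mu G)(f)=\varphi\circ f$ for $f\in A\rtimes_{\mathrm{alg}}G$, giving a functor on the category of $G$-C*-algebras with equivariant completely positive maps. For a C*-algebra $A$, $A\otimes_\mu C^*_\mu G:=A\rtimes_{\mu,\operatorname{id}}G$ is the $\mu$-crossed product of $A$ with respect to the trivial $G$-action. It is a C*-completion of the algebraic tensor product $A\odot C^*_\mu G$, where for $a\in A$ and $f\in\mathbb{C}G=\mathbb{C}\rtimes_{\mathrm{alg}}G$ the element $a\otimes f$ is the function $s\mapsto f(s)a$ in $A\rtimes_{\mathrm{alg}}G$. In particular $\mathbb{C}G\odot\mathbb{C}G\subseteq C^*_{\max}G\odot C^*_\mu G\subseteq C^*_{\max}G\otimes_\mu C^*_\mu G$. *)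

(* Defs.v *)
From HB Require Import structures.
From mathcomp Require Import all_boot all_order all_algebra.
From mathcomp Require Import finmap.
From mathcomp Require Import complex.
From mathcomp Require Import all_classical all_reals.
From mathcomp Require Import topology normedtype.

Set Implicit Arguments.
Unset Strict Implicit.
Unset Printing Implicit Defensive.

Import Order.TTheory GRing.Theory Num.Theory.
Import numFieldNormedType.Exports.

Local Open Scope classical_set_scope.
Local Open Scope complex_scope.
Local Open Scope ring_scope.

(* *-algebras are not assumed to be unital, so MathComp's (unital) algebra
   structures cannot be used for the product. *)

HB.mixin Record Lmodule_isStarAlgebra (R : realType) A of GRing.Lmodule R[i] A := {
  amul : A -> A -> A ;
  adj : A -> A ;
  amulA : associative amul ;
  amulDl : left_distributive amul +%R ;
  amulDr : right_distributive amul +%R ;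
  amulZl : forall (c : R[i]) (x y : A), amul (c *: x) y = c *: amul x y ;
  amulZr : forall (c : R[i]) (x y : A), amul x (c *: y) = c *: amul x y ;
  adjK : involutive adj ;
  adjD : {morph adj : x y / x + y} ;
  adjZ : forall (c : R[i]) (x : A), adj (c *: x) = conjc c *: adj x ;
  adjM : forall x y : A, adj (amul x y) = amul (adj y) (adj x)
}.

#[short(type="starAlgType")]
HB.structure Definition StarAlgebra (R : realType) :=
  {A of GRing.Lmodule R[i] A & Lmodule_isStarAlgebra R A}.

Notation "x ** y" := (amul x y) (at level 40, left associativity) : ring_scope.

HB.mixin Record NormedStar_isCStar (R : realType) A
    of NormedModule R[i] A & Lmodule_isStarAlgebra R A := {
  norm_amul : forall x y : A, `|x ** y| <= `|x| * `|y| ;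
  cstar_id : forall x : A, `|adj x ** x| = `|x| ^+ 2
}.

#[short(type="cstarAlgType")]
HB.structure Definition CStarAlgebra (R : realType) :=
  {A of CompleteNormedModule R[i] A & Lmodule_isStarAlgebra R A
      & NormedStar_isCStar R A}.

(* The library's norm on a module over R[i] takes its values in R[i]. *)
Definition rnorm (R : realType) (A : cstarAlgType R) (x : A) : R := complex.Re `|x|.

Section StarAlgebraTheory.
Context (R : realType) (A : starAlgType R).
Implicit Types x y : A.

Lemma amul0l x : 0 ** x = 0.
Proof. by apply: (addIr (0 ** x)); rewrite -amulDl !add0r. Qed.

Lemma amul0r x : x ** 0 = 0.
Proof. by apply: (addIr (x ** 0)); rewrite -amulDr !add0r. Qed.

Lemma adj0 : adj (0 : A) = 0.
Proof. by apply: (addIr (adj (0 : A))); rewrite -adjD !add0r. Qed.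

Lemma amul_suml (I : Type) (r : seq I) (F : I -> A) x :
  (\sum_(i <- r) F i) ** x = \sum_(i <- r) F i ** x.
Proof. exact: (big_morph (amul^~ x) (fun a b => amulDl a b x) (amul0l x)). Qed.

Lemma amul_sumr (I : Type) (r : seq I) (F : I -> A) x :
  x ** (\sum_(i <- r) F i) = \sum_(i <- r) x ** F i.
Proof. exact: (big_morph (amul x) (amulDr x) (amul0r x)). Qed.

Lemma adj_sum (I : Type) (r : seq I) (F : I -> A) :
  adj (\sum_(i <- r) F i) = \sum_(i <- r) adj (F i).
Proof. exact: (big_morph (@adj R A) adjD adj0). Qed.

End StarAlgebraTheory.

Record star_hom (R : realType) (A B : starAlgType R) := StarHom {
  star_hom_fun :> {linear A -> B} ;
  star_homM : {morph star_hom_fun : x y / x ** y} ;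
  star_hom_adj : {morph star_hom_fun : x / adj x}
}.

Section StarHomOps.
Context (R : realType).

Lemma star_hom_idM (A : starAlgType R) : {morph (idfun : A -> A) : x y / x ** y}.
Proof. by []. Qed.

Lemma star_hom_id_adj (A : starAlgType R) : {morph (idfun : A -> A) : x / adj x}.
Proof. by []. Qed.

Definition star_hom_id (A : starAlgType R) : star_hom A A :=
  @StarHom R A A (idfun : {linear A -> A}) (@star_hom_idM A) (@star_hom_id_adj A).

Context (A B D : starAlgType R) (psi : star_hom B D) (phi : star_hom A B).

Lemma star_hom_compM : {morph (psi \o phi) : x y / x ** y}.
Proof. by move=> x y /=; rewrite !star_homM. Qed.

Lemma star_hom_comp_adj : {morph (psi \o phi) : x / adj x}.
Proof. by move=> x /=; rewrite !star_hom_adj. Qed.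

Definition star_hom_comp : star_hom A D :=
  @StarHom R A D (psi \o phi : {linear A -> D}) star_hom_compM star_hom_comp_adj.

End StarHomOps.

Definition mx_amul (R : realType) (A : starAlgType R) n (X Y : 'M[A]_n) : 'M[A]_n :=
  \matrix_(i, j) \sum_k X i k ** Y k j.

Definition mx_adj (R : realType) (A : starAlgType R) n (X : 'M[A]_n) : 'M[A]_n :=
  \matrix_(i, j) adj (X j i).

Definition mx_positive (R : realType) (A : starAlgType R) n (X : 'M[A]_n) : Prop :=
  exists Y : 'M[A]_n, X = mx_amul (mx_adj Y) Y.

Definition completely_positive (R : realType) (A B : starAlgType R) (phi : A -> B) :=
  forall n (X : 'M[A]_n), mx_positive X -> mx_positive (map_mx phi X).

Record cp_map (R : realType) (A B : cstarAlgType R) := CpMap {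
  cp_fun :> {linear A -> B} ;
  cp_fun_cp : completely_positive cp_fun
}.

Section ComplexCStar.
Context (R : realType).

Definition Cstar_C : Type := R[i]^o.

HB.instance Definition _ := NormedModule.copy Cstar_C R[i]^o.

Lemma Cstar_C_complete (F : set_system Cstar_C) :
  ProperFilter F -> cauchy F -> cvg F.
Proof.
move=> FF /cauchyP Fc.
have part (p : R[i] -> R) : (forall z w, `|p z - p w|%:C <= `|z - w|) ->
    cvg (p @ F).
  move=> pN; apply: R_complete; apply: cauchy_exP => e e0.
  have [|z Fz] := Fc e%:C; first by rewrite ltcR.
  exists (p z); rewrite /nbhs /=; apply: filterS Fz => w.
  rewrite /ball /= => zw; rewrite -ltcR; exact: le_lt_trans (pN _ _) zw.
have Re_le (z w : R[i]) : `|complex.Re z - complex.Re w|%:C <= `|z - w|.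
  by rewrite -raddfB; exact: normc_ge_Re.
have Im_le (z w : R[i]) : `|complex.Im z - complex.Im w|%:C <= `|z - w|.
  rewrite -raddfB normc_def lecR -sqrtr_sqr ler_wsqrtr // lerDr sqr_ge0 //.
have /cvg_ex[/= a Fa] := part _ Re_le.
have /cvg_ex[/= b Fb] := part _ Im_le.
apply/cvg_ex; exists (a +i* b); apply/cvgrPdist_lt => e e0.
have [e' ee' e'0] : exists2 e' : R, e = e'%:C & 0 < e'.
  by exists (complex.Re e); rewrite ?RRe_real ?gtr0_real // -ltcR RRe_real ?gtr0_real.
rewrite {e e0}ee'; move/cvgrPdist_lt: Fa => /(_ (e' / 2)) Fa.
move/cvgrPdist_lt: Fb => /(_ (e' / 2)) Fb.
have e'2 : 0 < e' / 2 by rewrite divr_gt0.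
near=> z.
have zRe : `|a - complex.Re z| < e' / 2 by near: z; exact: Fa.
have zIm : `|b - complex.Im z| < e' / 2 by near: z; exact: Fb.
rewrite normc_def ltcR !raddfB /=.
apply: (@le_lt_trans _ _ (`|a - complex.Re z| + `|b - complex.Im z|)); last first.
  by rewrite [ltRHS]splitr ltrD.
rewrite -[leRHS]ger0_norm ?addr_ge0 // -sqrtr_sqr ler_wsqrtr //.
by rewrite [leRHS]sqrrD !real_normK ?num_real // lerD2r lerDl mulrn_wge0 // mulr_ge0.
Unshelve. all: by end_near. Qed.

HB.instance Definition _ := Uniform_isComplete.Build Cstar_C Cstar_C_complete.

Definition C_amul (x y : Cstar_C) : Cstar_C := (x : R[i]) * y.
Definition C_adj (x : Cstar_C) : Cstar_C := conjc (x : R[i]).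

Lemma C_amulA : associative C_amul.
Proof. exact: mulrA. Qed.
Lemma C_amulDl : left_distributive C_amul +%R.
Proof. exact: mulrDl. Qed.
Lemma C_amulDr : right_distributive C_amul +%R.
Proof. exact: mulrDr. Qed.
Lemma C_amulZl (c : R[i]) (x y : Cstar_C) : C_amul (c *: x) y = c *: C_amul x y.
Proof. by rewrite /C_amul -mulrA. Qed.
Lemma C_amulZr (c : R[i]) (x y : Cstar_C) : C_amul x (c *: y) = c *: C_amul x y.
Proof. by rewrite /C_amul mulrCA. Qed.
Lemma C_adjK : involutive C_adj.
Proof. exact: conjcK. Qed.
Lemma C_adjD : {morph C_adj : x y / x + y}.
Proof. by move=> x y; exact: rmorphD. Qed.
Lemma C_adjZ (c : R[i]) (x : Cstar_C) : C_adj (c *: x) = conjc c *: C_adj x.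
Proof. exact: rmorphM. Qed.
Lemma C_adjM (x y : Cstar_C) : C_adj (C_amul x y) = C_amul (C_adj y) (C_adj x).
Proof. by rewrite /C_adj /C_amul rmorphM mulrC. Qed.

HB.instance Definition _ := Lmodule_isStarAlgebra.Build R Cstar_C
  C_amulA C_amulDl C_amulDr C_amulZl C_amulZr C_adjK C_adjD C_adjZ C_adjM.

Lemma C_norm_amul (x y : Cstar_C) : `|x ** y| <= `|x| * `|y|.
Proof. by rewrite -normrM. Qed.
Lemma C_cstar_id (x : Cstar_C) : `|adj x ** x| = `|x| ^+ 2.
Proof. by rewrite [LHS]normrM norm_conjC -expr2. Qed.

HB.instance Definition _ := NormedStar_isCStar.Build R Cstar_C
  C_norm_amul C_cstar_id.

End ComplexCStar.

(* Each act g is automatically an automorphism, with inverse act g^-1. *)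

Record gcstar (R : realType) (G : groupType) := GCStar {
  gcstar_alg :> cstarAlgType R ;
  act : G -> star_hom gcstar_alg gcstar_alg ;
  act1 : forall x, act 1%g x = x ;
  actM : forall g h x, act (g * h)%g x = act g (act h x)
}.

Definition trivial_action (R : realType) (G : groupType) (A : cstarAlgType R) :
    gcstar R G :=
  @GCStar R G A (fun=> star_hom_id A) (fun=> erefl) (fun _ _ _ => erefl).

Definition equivariant (R : realType) (G : groupType) (A B : gcstar R G)
    (phi : A -> B) :=
  forall g x, phi (act A g x) = act B g (phi x).

Record ghom (R : realType) (G : groupType) (A B : gcstar R G) := GHom {
  ghom_fun :> star_hom A B ;
  ghom_equivariant : equivariant ghom_fun
}.

Record gcp_map (R : realType) (G : groupType) (A B : gcstar R G) := GCpMap {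
  gcp_fun :> cp_map A B ;
  gcp_equivariant : equivariant gcp_fun
}.

Section EquivariantOps.
Context (R : realType) (G : groupType).

Lemma ghom_id_equivariant (A : gcstar R G) : equivariant (star_hom_id A).
Proof. by []. Qed.

Definition ghom_id (A : gcstar R G) : ghom A A := GHom (@ghom_id_equivariant A).

Lemma cp_id (A : cstarAlgType R) : completely_positive (idfun : A -> A).
Proof. by move=> n X; rewrite map_mx_id. Qed.

Definition cp_map_id (A : cstarAlgType R) : cp_map A A :=
  @CpMap R A A (idfun : {linear A -> A}) (@cp_id A).

Lemma gcp_id_equivariant (A : gcstar R G) : equivariant (cp_map_id A).
Proof. by []. Qed.

Definition gcp_id (A : gcstar R G) : gcp_map A A := GCpMap (@gcp_id_equivariant A).

Context (A B D : gcstar R G).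

Lemma ghom_comp_equivariant (psi : ghom B D) (phi : ghom A B) :
  equivariant (star_hom_comp psi phi).
Proof. by move=> g x /=; rewrite !ghom_equivariant. Qed.

Definition ghom_comp (psi : ghom B D) (phi : ghom A B) : ghom A D :=
  GHom (ghom_comp_equivariant psi phi).

Lemma cp_comp (psi : cp_map B D) (phi : cp_map A B) :
  completely_positive (psi \o phi).
Proof.
move=> n X posX; rewrite map_mx_comp.
by apply: cp_fun_cp; apply: cp_fun_cp.
Qed.

Definition cp_map_comp (psi : cp_map B D) (phi : cp_map A B) : cp_map A D :=
  @CpMap R A D (psi \o phi : {linear A -> D}) (cp_comp psi phi).

Lemma gcp_comp_equivariant (psi : gcp_map B D) (phi : gcp_map A B) :
  equivariant (cp_map_comp psi phi).
Proof. by move=> g x /=; rewrite !gcp_equivariant. Qed.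

Definition gcp_comp (psi : gcp_map B D) (phi : gcp_map A B) : gcp_map A D :=
  GCpMap (gcp_comp_equivariant psi phi).

End EquivariantOps.

Section AlgebraicCrossedProduct.
Context (R : realType) (G : groupType) (A : gcstar R G).

Definition finsupp_pred : {pred G -> A} :=
  [pred f | `[< finite_set [set s | f s != 0] >]].

Lemma finsupp_submod : submod_closed finsupp_pred.
Proof.
split; first by apply/asboolP; rewrite (_ : mkset _ = set0) // -subset0 => s /=; rewrite eqxx.
move=> c f g /asboolP ff /asboolP fg; apply/asboolP.
apply: (@sub_finite_set _ _ ([set s | f s != 0] `|` [set s | g s != 0])).
  move=> s /=; apply: contraNP => /not_orP [/negP/negPn/eqP f0 /negP/negPn/eqP g0].
  have -> : (c *: f + g) s = c *: f s + g s by [].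
  by rewrite f0 g0 scaler0 addr0.
by rewrite finite_setU.
Qed.

HB.instance Definition _ := GRing.isSubmodClosed.Build R[i] (G -> A) finsupp_pred
  finsupp_submod.

Record alg_crossed := AlgCrossed {
  alg_crossed_fun :> G -> A ;
  alg_crossed_finsupp : alg_crossed_fun \in finsupp_pred
}.

HB.instance Definition _ := [isSub for alg_crossed_fun].
HB.instance Definition _ := [Choice of alg_crossed by <:].
HB.instance Definition _ := [SubChoice_isSubLmodule of alg_crossed by <:].


Lemma alg_crossed_supp (f : alg_crossed) : finite_set [set s | f s != 0].
Proof. by have /asboolP := alg_crossed_finsupp f. Qed.

Lemma alg_crossedP (f g : alg_crossed) : (forall t, f t = g t) -> f = g.
Proof. by move=> fg; apply/val_inj/funext. Qed.

Lemma alg_crossedDE (f g : alg_crossed) t : (f + g) t = f t + g t.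
Proof. by []. Qed.

Lemma alg_crossedZE (c : R[i]) (f : alg_crossed) t : (c *: f) t = c *: f t.
Proof. by []. Qed.

Definition conv_fun (f g : alg_crossed) (t : G) : A :=
  \sum_(s \in [set: G]) f s ** act A s (g (s^-1 * t)%g).

Definition adj_fun (f : alg_crossed) (s : G) : A :=
  act A s (adj (f (s^-1)%g)).

(* The regular representation of C_c(G, A) on the Hilbert A-module l^2(G, A):
   a acts on xi by t |-> act t^-1 a ** xi t, and s by left translation. *)
Definition regular_fun (f xi : alg_crossed) (t : G) : A :=
  \sum_(s \in [set: G]) act A (t^-1)%g (f s) ** xi (s^-1 * t)%g.

Lemma mul_supp (f g : alg_crossed) (F : G -> G -> A) :
  (forall s t, f s = 0 -> F s t = 0) ->
  (forall s t, g (s^-1 * t)%g = 0 -> F s t = 0) ->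
  (fun t => \sum_(s \in [set: G]) F s t) \in finsupp_pred.
Proof.
move=> F0 G0; apply/asboolP.
apply: (@sub_finite_set _ _
  ((fun p => p.1 * p.2)%g @` ([set s | f s != 0] `*` [set s | g s != 0]))); last first.
  by apply: finite_image; apply: finite_setX; exact: alg_crossed_supp.
move=> t /= /eqP; apply: contra_notP => nt; apply: fsbig1 => s _.
have [/F0//|fs] := eqVneq (f s) 0; have [/G0//|gs] := eqVneq (g (s^-1 * t)%g) 0.
by case: nt; exists (s, (s^-1 * t)%g) => //=; rewrite mulVKg.
Qed.

Lemma conv_finsupp (f g : alg_crossed) : conv_fun f g \in finsupp_pred.
Proof.
apply: (mul_supp (f := f) (g := g)) => s t ->; first exact: amul0l.
by rewrite raddf0 amul0r.
Qed.

Lemma regular_finsupp (f xi : alg_crossed) : regular_fun f xi \in finsupp_pred.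
Proof.
apply: (mul_supp (f := f) (g := xi)) => s t ->; last exact: amul0r.
by rewrite raddf0 amul0l.
Qed.

Lemma adj_finsupp (f : alg_crossed) : adj_fun f \in finsupp_pred.
Proof.
apply/asboolP; apply: (@sub_finite_set _ _ ((fun s => s^-1)%g @` [set s | f s != 0])).
  move=> s /=; have [f0|fs _] := eqVneq (f (s^-1)%g) 0.
    by rewrite /adj_fun f0 adj0 raddf0 eqxx.
  by exists (s^-1)%g => //; rewrite invgK.
by apply: finite_image; exact: alg_crossed_supp.
Qed.

Definition conv f g := AlgCrossed (conv_finsupp f g).
Definition alg_crossed_adj f := AlgCrossed (adj_finsupp f).
Definition regular_rep f xi := AlgCrossed (regular_finsupp f xi).

Definition supp (f : alg_crossed) : {fset G} := fset_set [set s | f s != 0].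

Lemma suppPn f s : s \notin supp f -> f s = 0.
Proof.
rewrite in_fset_set; last exact: alg_crossed_supp.
by move=> /negP; rewrite inE /= => /negP; rewrite negbK => /eqP.
Qed.

Implicit Types f g xi eta : alg_crossed.

Lemma act_sum (I : Type) (r : seq I) (F : I -> A) t :
  act A t (\sum_(i <- r) F i) = \sum_(i <- r) act A t (F i).
Proof. exact: raddf_sum. Qed.

Lemma convE (D : {fset G}) f g t : (forall s, s \notin D -> f s = 0) ->
  conv f g t = \sum_(s <- D) f s ** act A s (g (s^-1 * t)%g).
Proof. by move=> D0; rewrite /= /conv_fun (fsbigTE D) // => s /D0 ->; rewrite amul0l. Qed.

Lemma convA : associative conv.
Proof.
move=> f g h; apply: alg_crossedP => t.
pose D := ((fun p => p.1 * p.2)%g @` (supp f `*` supp g))%fset.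
have D0 s u : u \notin D -> s \in supp f -> g (s^-1 * u)%g = 0.
  move=> /negP uD sf; apply: suppPn; apply/negP => gu; apply: uD.
  by apply/imfsetP; exists (s, s^-1 * u)%g; rewrite ?inE ?sf //= mulVKg.
rewrite (convE (D := supp f)); last exact: suppPn.
rewrite (convE (D := D)); last first.
  move=> u uD; rewrite (convE (D := supp f)); last exact: suppPn.
  by rewrite big_seq big1 // => s sf; rewrite (D0 s u) // raddf0 amul0r.
transitivity (\sum_(s <- supp f) \sum_(u <- D)
   (f s ** act A s (g (s^-1 * u)%g)) ** act A u (h (u^-1 * t)%g)); last first.
  rewrite exchange_big /=; apply: eq_bigr => u _.
  by rewrite -amul_suml -(convE (D := supp f)) //; exact: suppPn.
apply: eq_big_seq => s sf /=; rewrite /conv_fun.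
have bij : bijective (fun u => s^-1 * u)%g.
  by exists (fun u => s * u)%g => u; rewrite ?mulVKg ?mulKg.
rewrite (reindex_fsbigT _ _ bij) (fsbigTE D); last first.
  by move=> u uD; rewrite (D0 s u) // amul0l.
rewrite act_sum amul_sumr; apply: eq_bigr => u _.
by rewrite star_homM amulA -actM mulVKg invgM invgK -mulgA mulVKg.
Qed.

Lemma convDl : left_distributive conv +%R.
Proof.
move=> f g h; apply: alg_crossedP => t; rewrite alg_crossedDE.
pose D := (supp f `|` supp g)%fset.
have D0 s : s \notin D -> (f s = 0) * (g s = 0).
  by rewrite inE negb_or => /andP[/suppPn -> /suppPn ->].
rewrite !(convE (D := D)) => [|s /D0[]//|s /D0[]//|s /D0[fs gs]].
  by rewrite -big_split; apply: eq_bigr => s _; rewrite alg_crossedDE amulDl.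
by rewrite alg_crossedDE fs gs addr0.
Qed.

Lemma convDr : right_distributive conv +%R.
Proof.
move=> f g h; apply: alg_crossedP => t; rewrite alg_crossedDE.
rewrite !(convE (D := supp f)); try exact: suppPn.
by rewrite -big_split; apply: eq_bigr => s _; rewrite alg_crossedDE raddfD amulDr.
Qed.

Lemma convZl (c : R[i]) f g : conv (c *: f) g = c *: conv f g.
Proof.
apply: alg_crossedP => t; rewrite alg_crossedZE.
rewrite !(convE (D := supp f)) => [|s /suppPn //|s /suppPn fs]; last first.
  by rewrite alg_crossedZE fs scaler0.
by rewrite scaler_sumr; apply: eq_bigr => s _; rewrite alg_crossedZE amulZl.
Qed.

Lemma convZr (c : R[i]) f g : conv f (c *: g) = c *: conv f g.
Proof.
apply: alg_crossedP => t; rewrite alg_crossedZE.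
rewrite !(convE (D := supp f)); try exact: suppPn.
by rewrite scaler_sumr; apply: eq_bigr => s _; rewrite alg_crossedZE linearZ amulZr.
Qed.

Lemma alg_crossed_adjK : involutive alg_crossed_adj.
Proof.
move=> f; apply: alg_crossedP => t; rewrite /= /adj_fun /= /adj_fun.
by rewrite invgK -star_hom_adj adjK -actM mulgV act1.
Qed.

Lemma alg_crossed_adjD : {morph alg_crossed_adj : f g / f + g}.
Proof.
by move=> f g; apply: alg_crossedP => t; rewrite /= /adj_fun !alg_crossedDE adjD raddfD.
Qed.

Lemma alg_crossed_adjZ (c : R[i]) f :
  alg_crossed_adj (c *: f) = conjc c *: alg_crossed_adj f.
Proof.
by apply: alg_crossedP => t; rewrite /= /adj_fun !alg_crossedZE adjZ linearZ.
Qed.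

Lemma alg_crossed_adjM f g :
  alg_crossed_adj (conv f g) = conv (alg_crossed_adj g) (alg_crossed_adj f).
Proof.
apply: alg_crossedP => t.
rewrite [LHS]/= /adj_fun (convE (D := supp f)); last exact: suppPn.
have bij : bijective (fun s => t * s)%g.
  by exists (fun s => t^-1 * s)%g => s; rewrite ?mulVKg ?mulKg.
have tsK s : act A (t * s)%g (alg_crossed_adj f ((t * s)^-1 * t)%g)
    = act A t (adj (f s)).
  have inv_ts : (((t * s)^-1 * t)^-1 = s)%g by rewrite (invgM _ t) invgK mulKg.
  by rewrite [alg_crossed_adj f _]/= /adj_fun inv_ts -actM mulVKg.
rewrite [RHS]/= /conv_fun (reindex_fsbigT _ _ bij) (fsbigTE (supp f)); last first.
  by move=> s /suppPn fs; rewrite tsK fs adj0 raddf0 amul0r.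
rewrite adj_sum act_sum; apply: eq_bigr => s _; rewrite tsK.
by rewrite adjM star_homM -star_hom_adj -actM [alg_crossed_adj g _]/= /adj_fun invgM.
Qed.

HB.instance Definition _ := Lmodule_isStarAlgebra.Build R alg_crossed
  convA convDl convDr convZl convZr
  alg_crossed_adjK alg_crossed_adjD alg_crossed_adjZ alg_crossed_adjM.

(* On the dense submodule C_c(G, A) of l^2(G, A). *)
Definition inner (xi eta : alg_crossed) : A :=
  \sum_(t \in [set: G]) adj (xi t) ** eta t.

Definition l2norm (xi : alg_crossed) : R := Num.sqrt (rnorm (inner xi xi)).

(* The operator norm of the regular representation; C_c(G, A) being dense in
   l^2(G, A), vectors in C_c(G, A) suffice. *)
Definition reduced_norm (f : alg_crossed) : R :=
  sup [set l2norm (regular_rep f xi) | xi in [set xi | l2norm xi <= 1]].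

End AlgebraicCrossedProduct.
Arguments finsupp_pred {R G} A.

Section AlgebraicCrossedProductMap.
Context (R : realType) (G : groupType) (A B : gcstar R G) (phi : {linear A -> B}).

Lemma map_finsupp (f : alg_crossed A) : (phi \o f) \in finsupp_pred B.
Proof.
apply/asboolP; apply: sub_finite_set (alg_crossed_supp f) => s /=.
by apply: contraNN => /eqP ->; rewrite raddf0.
Qed.

Definition alg_crossed_map (f : alg_crossed A) : alg_crossed B :=
  AlgCrossed (map_finsupp f).

End AlgebraicCrossedProductMap.

Record cstar_functor (R : realType) (G : groupType) := CStarFunctor {
  fobj :> gcstar R G -> cstarAlgType R ;
  fmap : forall A B : gcstar R G, ghom A B -> star_hom (fobj A) (fobj B) ;
  fmap_id : forall (A : gcstar R G) x, fmap (ghom_id A) x = x ;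
  fmap_comp : forall (A B D : gcstar R G) (psi : ghom B D) (phi : ghom A B) x,
    fmap (ghom_comp psi phi) x = fmap psi (fmap phi x)
}.

Record nat_trans (R : realType) (G : groupType) (F F' : cstar_functor R G) := NatTrans {
  component :> forall A : gcstar R G, star_hom (F A) (F' A) ;
  natural : forall (A B : gcstar R G) (phi : ghom A B) x,
    component B (fmap F phi x) = fmap F' phi (component A x)
}.

(* A functor F such that F A contains C_c(G, A) as a dense *-subalgebra, with
   F phi extending f |-> phi \o f. *)
Record completion_functor (R : realType) (G : groupType) := CompletionFunctor {
  completion_fun :> cstar_functor R G ;
  emb : forall A : gcstar R G, star_hom (alg_crossed A) (completion_fun A) ;
  emb_inj : forall A : gcstar R G, injective (emb A) ;
  emb_dense : forall A : gcstar R G, dense (range (emb A)) ;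
  emb_map : forall (A B : gcstar R G) (phi : ghom A B) (f : alg_crossed A),
    fmap completion_fun phi (emb A f) = emb B (alg_crossed_map phi f)
}.

(* The maximal crossed product is determined up to isomorphism by its universal
   property: every *-homomorphism from C_c(G, A) to a C*-algebra extends to it,
   so that its norm is the largest C*-norm on C_c(G, A). *)
Record maximal_crossed_product (R : realType) (G : groupType) := MaximalCrossedProduct {
  max_fun :> completion_functor R G ;
  max_ext : forall (A : gcstar R G) (B : cstarAlgType R),
    star_hom (alg_crossed A) B -> star_hom (max_fun A) B ;
  max_extE : forall (A : gcstar R G) (B : cstarAlgType R)
      (pi : star_hom (alg_crossed A) B) (f : alg_crossed A),
    max_ext pi (emb max_fun A f) = pi f
}.

Record reduced_crossed_product (R : realType) (G : groupType) := ReducedCrossedProduct {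
  red_fun :> completion_functor R G ;
  red_norm : forall (A : gcstar R G) (f : alg_crossed A),
    rnorm (emb red_fun A f) = reduced_norm f
}.

Definition Lambda (R : realType) (G : groupType) (Fmax : maximal_crossed_product R G)
    (Fred : reduced_crossed_product R G) (A : gcstar R G) : star_hom (Fmax A) (Fred A) :=
  max_ext Fmax (emb Fred A).

Record crossed_product_functor (R : realType) (G : groupType)
    (Fmax : maximal_crossed_product R G) (Fred : reduced_crossed_product R G) :=
    CrossedProductFunctor {
  mu_fun :> cstar_functor R G ;
  mu_q : nat_trans Fmax mu_fun ;
  mu_s : nat_trans mu_fun Fred ;
  mu_q_surj : forall A : gcstar R G, set_surj setT setT (mu_q A) ;
  mu_s_surj : forall A : gcstar R G, set_surj setT setT (mu_s A) ;
  mu_factor : forall (A : gcstar R G) (x : Fmax A),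
    mu_s A (mu_q A x) = Lambda Fmax Fred A x
}.

Section CorrespondenceFunctors.
Context (R : realType) (G : groupType).
Context (Fmax : maximal_crossed_product R G) (Fred : reduced_crossed_product R G).
Context (mu : crossed_product_functor Fmax Fred).

(* C_c(G, A) as a dense *-subalgebra of the mu-crossed product. *)
Definition mu_emb (A : gcstar R G) : star_hom (alg_crossed A) (mu A) :=
  star_hom_comp (mu_q mu A) (emb Fmax A).

(* The first condition determines the maps; the other two say that they form a
   functor on G-C*-algebras with equivariant completely positive maps. *)
Definition correspondence_functor : Prop :=
  exists cpmap : forall A B : gcstar R G, gcp_map A B -> cp_map (mu A) (mu B),
    [/\ forall (A B : gcstar R G) (phi : gcp_map A B) (f : alg_crossed A),
          cpmap A B phi (mu_emb A f) = mu_emb B (alg_crossed_map phi f),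
        forall (A : gcstar R G) x, cpmap A A (gcp_id A) x = x
      & forall (A B D : gcstar R G) (psi : gcp_map B D) (phi : gcp_map A B) x,
          cpmap A D (gcp_comp psi phi) x = cpmap B D psi (cpmap A B phi x)].

Definition group_algebra := alg_crossed (trivial_action G (Cstar_C R)).

Definition Cstar_max : cstarAlgType R := Fmax (trivial_action G (Cstar_C R)).

Definition Cstar_mu : cstarAlgType R := mu (trivial_action G (Cstar_C R)).

(* A (x)_mu C*_mu G *)
Definition mu_tensor (A : cstarAlgType R) : cstarAlgType R := mu (trivial_action G A).

Lemma group_elt_finsupp (g : G) :
  (fun s => (s == g)%:R : Cstar_C R) \in finsupp_pred (trivial_action G (Cstar_C R)).
Proof.
apply/asboolP; apply: sub_finite_set (finite_set1 g) => s /=.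
by have [->|] := eqVneq s g; rewrite ?eqxx.
Qed.

Definition group_elt (g : G) : group_algebra := AlgCrossed (group_elt_finsupp g).

Section ElementaryTensor.
Context (A : cstarAlgType R) (a : A) (f : group_algebra).

Lemma elem_tensor_finsupp :
  (fun s => (f s : R[i]) *: a) \in finsupp_pred (trivial_action G A).
Proof.
apply/asboolP; apply: sub_finite_set (alg_crossed_supp f) => s /=.
by apply: contraNN => /eqP ->; rewrite scale0r.
Qed.

Definition elem_tensor : mu_tensor A :=
  mu_emb (trivial_action G A) (AlgCrossed elem_tensor_finsupp).

End ElementaryTensor.

(* The coproduct, with C[G] (.) C[G] viewed inside C*_max G (x)_mu C*_mu G. *)
Definition coproduct (f : group_algebra) : mu_tensor Cstar_max :=
  \sum_(g \in [set: G])
    (f g : R[i]) *: elem_tensor (emb Fmax _ (group_elt g) : Cstar_max) (group_elt g).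

End CorrespondenceFunctors.

(* Main.v *)
From HB Require Import structures.
From mathcomp Require Import all_boot all_order all_algebra.
From mathcomp Require Import finmap complex ring lra.
From mathcomp Require Import all_classical all_reals.
From mathcomp Require Import topology normedtype.
Require Import Defs.

Set Implicit Arguments.
Unset Strict Implicit.
Unset Printing Implicit Defensive.

Import Order.TTheory GRing.Theory Num.Theory.
Import numFieldNormedType.Exports.

Local Open Scope classical_set_scope.
Local Open Scope complex_scope.
Local Open Scope ring_scope.

(** Write M for C*_max G, with its canonical unitaries u_g. The coproduct ought
to be the inclusion of the scalars into M with the inner action, followed by an
isomorphism a g |-> a u_g (x) g of crossed products onto that of M with the
trivial action. A correspondence functor provides what is needed of this
isomorphism, because the two actions on M are corners of one action: D is the
algebra of 2 by 2 matrices over M with the action conjugating by diag (u_g, 1).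
The map kappa : z |-> z E_11 from the scalars to D is an equivariant
*-homomorphism, and the lower right entry D -> M is equivariant, for the trivial
action on M, and completely positive; both induce maps on crossed products.
Multiplying between them by the matrix units E_21 and E_12, placed at the
identity of G, gives

  Delta x = entry (E_21 (kappa x) E_12),

and since the action sends E_12 to u_g E_12, this is f |-> (s |-> f s u_s) on
C[G] ([entry_conj_corner], [entry_twist]): the coproduct ([coproductE]). So
Delta extends the coproduct, and it is a *-homomorphism because it is continuous
and is one on a dense *-subalgebra ([dense_morphism]).

This leaves the continuity of a completely positive map between C*-algebras,
and the complete positivity of the entry map in the form asked for, where
positive matrices are of the form Y^* Y with Y square. Both rest on elementary
positivity in a unital C*-algebra: a condition on norms defines a cone ([posD]) of
elements with square roots ([pos_sqrt]), and it contains every x^* x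
([pos_adjmul]).
Positive linear maps are then bounded ([positive_map_bounded]). For the entry
map, a sum of two squares has to be rewritten as one square in the n by n
matrices over M ([entry_completely_positive]); so these matrices, which also
provide D, are made into a C*-algebra, with the operator norm on the Hilbert
module M^n ([ucstar_mx]).

Spectral theory is not used: square roots come from an iteration, and norm
estimates from completing h to a unitary h + i k ([norm_le_sum_squares]). *)

(** * Real-valued norms *)

Lemma real_gt0 (R : realType) (e : R[i]) : 0 < e -> exists2 t : R, e = t%:C & 0 < t.
Proof.
move=> e0; exists (complex.Re e); first by rewrite RRe_real ?gtr0_real.
by rewrite -ltcR RRe_real ?gtr0_real.
Qed.

Lemma Re_norm_ge0 (R : realType) (c : R[i]) : 0 <= complex.Re `|c|.
Proof. by rewrite -ler0c RRe_real // normr_real. Qed.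

Section RealNorm.
Context (R : realType) (A : cstarAlgType R).
Implicit Types (x y : A) (t : R).

Lemma normE x : `|x| = (rnorm x)%:C.
Proof. by rewrite /rnorm RRe_real // normr_real. Qed.

Lemma rnorm_ge0 x : 0 <= rnorm x.
Proof. by rewrite -lecR -normE normr_ge0. Qed.

Lemma rnorm0 : rnorm (0 : A) = 0.
Proof. by rewrite /rnorm normr0. Qed.

Lemma rnorm_eq0 x : rnorm x = 0 -> x = 0.
Proof. by move=> x0; apply/eqP; rewrite -normr_eq0 normE x0. Qed.

Lemma rnormN x : rnorm (- x) = rnorm x.
Proof. by rewrite /rnorm normrN. Qed.

Lemma rnormD x y : rnorm (x + y) <= rnorm x + rnorm y.
Proof. by rewrite -lecR rmorphD /= -!normE ler_normD. Qed.

Lemma rnormB x y : rnorm (x - y) <= rnorm x + rnorm y.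
Proof. by rewrite -(rnormN y) rnormD. Qed.

Lemma rdistC x y : rnorm (x - y) = rnorm (y - x).
Proof. by rewrite -rnormN opprB. Qed.

Lemma rnormZ (c : R[i]) x : rnorm (c *: x) = complex.Re `|c| * rnorm x.
Proof.
by apply: complexI; rewrite rmorphM /= -!normE normrZ.
Qed.

Lemma rnormZr t x : rnorm (t%:C *: x) = `|t| * rnorm x.
Proof. by rewrite rnormZ normc_def /= expr0n addr0 sqrtr_sqr. Qed.

Lemma rnormZi x : rnorm ('i%C *: x) = rnorm x.
Proof. by rewrite rnormZ normc_def /= expr0n add0r expr1n sqrtr1 mul1r. Qed.

Lemma rnormM x y : rnorm (x ** y) <= rnorm x * rnorm y.
Proof. by rewrite -lecR rmorphM /= -!normE norm_amul. Qed.

Lemma rnorm_cstar x : rnorm (adj x ** x) = rnorm x ^+ 2.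
Proof. by apply: complexI; rewrite rmorphXn /= -!normE cstar_id. Qed.

Lemma rnorm_adj x : rnorm (adj x) = rnorm x.
Proof.
have le y : rnorm y <= rnorm (adj y).
  have := rnormM (adj y) y; rewrite rnorm_cstar expr2.
  have [->|y0] := eqVneq (rnorm y) 0; first by rewrite rnorm_ge0.
  by rewrite ler_pM2r // lt_def y0 rnorm_ge0.
by apply/eqP; rewrite eq_le le -{2}(adjK x) le.
Qed.

Lemma rnorm_sa x : adj x = x -> rnorm (x ** x) = rnorm x ^+ 2.
Proof. by move=> xs; rewrite -{1}xs rnorm_cstar. Qed.

Lemma rnorm_small x : (forall e, 0 < e -> rnorm x <= e) -> x = 0.
Proof.
move=> H; apply: rnorm_eq0; apply/eqP; rewrite eq_le rnorm_ge0 andbT.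
by apply/ler_addgt0Pl => e e0; rewrite addr0 H.
Qed.

Lemma dense_rnorm (B : set A) : dense B ->
  forall x e, 0 < e -> exists2 y, B y & rnorm (x - y) < e.
Proof.
move=> dB x e e0.
have eC0 : 0 < e%:C :> R[i] by rewrite ltcR.
have [|y [/= xy By]] := dB (ball x e%:C) _ (ball_open x e%:C).
  by exists x; exact: ballxx.
exists y => //; move: xy; rewrite -ball_normE /ball_ /= normE ltcR //.
Qed.

(** A sequence whose increments are dominated by those of a bounded real
sequence converges: this is how completeness is used. *)
Lemma dominated_increments_cvg (u : nat -> A) (q : nat -> R) (b : R) :
  (forall n, q n <= b) ->
  (forall n, rnorm (u n.+1 - u n) <= q n.+1 - q n) ->
  exists l, forall e, 0 < e -> exists N, forall n, (N <= n)%N -> rnorm (l - u n) < e.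
Proof.
move=> qb uq.
have umn m k : rnorm (u (m + k)%N - u m) <= q (m + k)%N - q m.
  elim: k => [|k IH]; first by rewrite addn0 !subrr rnorm0.
  rewrite addnS -(subrKA (u (m + k)%N)).
  by apply: le_trans (rnormD _ _) _; have := uq (m + k)%N; lra.
have qm m n : (m <= n)%N -> q m <= q n.
  move=> mn; have := umn m (n - m)%N; rewrite subnKC //.
  by have := rnorm_ge0 (u n - u m); lra.
have hs : has_sup (range q).
  by split; [exists (q 0%N); exists 0%N|exists b => _ [n _ <-]].
have ucau e : 0 < e -> exists N, forall n, (N <= n)%N -> rnorm (u n - u N) < e.
  move=> e0; have [_ [N _ <-] qN] := sup_adherent e0 hs.
  exists N => n Nn; have := umn N (n - N)%N; rewrite subnKC //.
  have : q n <= sup (range q) by apply: sup_upper_bound => //; exists n.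
  by lra.
have /cvg_ex[/= l ul] : cvg (u @ \oo).
  apply: cauchy_cvg; apply: cauchy_exP => e e0.
  have [e' ee' e'0] := real_gt0 e0.
  have [N NP] := ucau _ e'0; exists (u N); exists N => // n /= Nn.
  by rewrite -ball_normE /ball_ /= normE ee' ltcR rdistC NP.
exists l => e e0; move/cvgrPdist_lt: ul => /(_ e%:C); rewrite ltcR => /(_ e0)[N _ NP].
by exists N => n Nn; have := NP n Nn; rewrite /= normE ltcR.
Qed.

End RealNorm.

(** * Identities in unital C*-algebras *)

Record unital_cstar (R : realType) := UnitalCStar {
  ucstar :> cstarAlgType R ;
  uone : ucstar ;
  uone_amul : left_id uone (@amul R ucstar) ;
  amul_uone : right_id uone (@amul R ucstar)
}.
Arguments uone {R u}.

Inductive nc_expr (K : Type) :=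
  NcAtom of nat | NcOne | NcZero | NcAdd of nc_expr K & nc_expr K
| NcOpp of nc_expr K | NcMul of nc_expr K & nc_expr K | NcScale of K & nc_expr K.
Arguments NcAtom {K}.
Arguments NcOne {K}.
Arguments NcZero {K}.

(** The product of a unital C*-algebra is not the product of a ring structure,
and is not commutative, so that [ring] does not apply to it. The following
normalises an identity to one equation between scalars for each word in the
atoms; [ring] or [field] then solve these. The functions on words are
redefined here so that they, and nothing else, can be unfolded. *)
Section NoncommutativeNormalisation.
Context (R : realType) (A : unital_cstar R).
Notation K := R[i].

Fixpoint word_letter_eq (m n : nat) : bool :=
  match m, n with
  | O, O => true | S m', S n' => word_letter_eq m' n' | _, _ => false
  end.

Fixpoint word_eq (v w : seq nat) : bool :=
  match v, w with
  | [::], [::] => true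
  | m :: v', n :: w' => if word_letter_eq m n then word_eq v' w' else false
  | _, _ => false
  end.

Fixpoint word_cat (v w : seq nat) : seq nat :=
  if v is m :: v' then m :: word_cat v' w else w.

Fixpoint ncp_cat (p q : seq (K * seq nat)) :=
  if p is m :: p' then m :: ncp_cat p' q else q.

Fixpoint ncp_mulm (c : K) (v : seq nat) (q : seq (K * seq nat)) :=
  if q is (d, w) :: q' then (c * d, word_cat v w) :: ncp_mulm c v q' else [::].

Fixpoint ncp_mul (p q : seq (K * seq nat)) :=
  if p is (c, v) :: p' then ncp_cat (ncp_mulm c v q) (ncp_mul p' q) else [::].

Fixpoint ncp_of (e : nc_expr K) : seq (K * seq nat) :=
  match e with
  | NcAtom i => [:: (1, [:: i])]
  | NcOne => [:: (1, [::])]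
  | NcZero => [::]
  | NcAdd e1 e2 => ncp_cat (ncp_of e1) (ncp_of e2)
  | NcOpp e1 => ncp_mulm (-1) [::] (ncp_of e1)
  | NcMul e1 e2 => ncp_mul (ncp_of e1) (ncp_of e2)
  | NcScale c e1 => ncp_mulm c [::] (ncp_of e1)
  end.

Fixpoint ncp_coef (w : seq nat) (p : seq (K * seq nat)) : K :=
  if p is (c, v) :: p' then
    if word_eq v w then c + ncp_coef w p' else ncp_coef w p'
  else 0.

Fixpoint ncp_drop (w : seq nat) (p : seq (K * seq nat)) :=
  if p is (c, v) :: p' then
    if word_eq v w then ncp_drop w p' else (c, v) :: ncp_drop w p'
  else [::].

(* The first argument bounds the length of the second, for termination. *)
Fixpoint ncp_null (k : seq (K * seq nat)) (p : seq (K * seq nat)) : Prop :=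
  match k, p with
  | _ :: k', (c, v) :: p' =>
      c + ncp_coef v p' = 0 /\ ncp_null k' (ncp_drop v p')
  | _, _ => p = [::]
  end.

Definition nc_eq (e1 e2 : nc_expr K) : Prop :=
  let p := ncp_of (NcAdd e1 (NcOpp e2)) in ncp_null p p.

Context (env : seq A).

Fixpoint nc_eval (e : nc_expr K) : A :=
  match e with
  | NcAtom i => nth 0 env i
  | NcOne => uone
  | NcZero => 0
  | NcAdd e1 e2 => nc_eval e1 + nc_eval e2
  | NcOpp e1 => - nc_eval e1
  | NcMul e1 e2 => nc_eval e1 ** nc_eval e2
  | NcScale c e1 => c *: nc_eval e1
  end.

Fixpoint word_eval (w : seq nat) : A :=
  if w is i :: w' then nth 0 env i ** word_eval w' else uone.

Fixpoint ncp_eval (p : seq (K * seq nat)) : A :=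
  if p is (c, w) :: p' then c *: word_eval w + ncp_eval p' else 0.

Lemma word_eqP v w : word_eq v w -> v = w.
Proof.
elim: v w => [|m v IH] [|n w] //=; case E: word_letter_eq => // /IH ->.
by congr (_ :: _); elim: m n E => [|m IHm] [|n] //= /IHm ->.
Qed.

Lemma ncp_eval_cat p q : ncp_eval (ncp_cat p q) = ncp_eval p + ncp_eval q.
Proof. by elim: p => [|[c w] p IH] /=; rewrite ?add0r // IH addrA. Qed.

Lemma word_eval_cat v w : word_eval (word_cat v w) = word_eval v ** word_eval w.
Proof. by elim: v => [|m v IH] /=; rewrite ?uone_amul // IH amulA. Qed.

Lemma ncp_eval_mulm c v q :
  ncp_eval (ncp_mulm c v q) = (c *: word_eval v) ** ncp_eval q.
Proof.
elim: q => [|[d w] q IH] /=; first by rewrite amul0r.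
by rewrite IH amulDr word_eval_cat amulZl amulZr amulZl scalerA (mulrC d).
Qed.

Lemma ncp_eval_mul p q : ncp_eval (ncp_mul p q) = ncp_eval p ** ncp_eval q.
Proof.
elim: p => [|[c v] p IH] /=; first by rewrite amul0l.
by rewrite ncp_eval_cat ncp_eval_mulm IH amulDl.
Qed.

Lemma ncp_ofE e : ncp_eval (ncp_of e) = nc_eval e.
Proof.
elim: e => [i|||e1 IH1 e2 IH2|e IH|e1 IH1 e2 IH2|c e IH] /=.
- by rewrite scale1r amul_uone addr0.
- by rewrite scale1r addr0.
- by [].
- by rewrite ncp_eval_cat IH1 IH2.
- by rewrite ncp_eval_mulm IH amulZl uone_amul scaleN1r.
- by rewrite ncp_eval_mul IH1 IH2.
- by rewrite ncp_eval_mulm IH amulZl uone_amul.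
Qed.

Lemma ncp_eval_split w p :
  ncp_eval p = ncp_coef w p *: word_eval w + ncp_eval (ncp_drop w p).
Proof.
elim: p => [|[c v] p IH] /=; first by rewrite scale0r addr0.
case E: word_eq => /=; rewrite IH; last by rewrite addrCA.
by rewrite (word_eqP E) scalerDl addrA.
Qed.

Lemma ncp_nullP k p : ncp_null k p -> ncp_eval p = 0.
Proof.
elim: k p => [|_ k IH] [|[c v] p] //= [cp /IH p0].
by rewrite (ncp_eval_split v p) p0 addr0 -scalerDl cp scale0r.
Qed.

Lemma nc_eqP e1 e2 : nc_eq e1 e2 -> nc_eval e1 = nc_eval e2.
Proof.
move=> /ncp_nullP; rewrite ncp_ofE /= => e12.
by apply/eqP; rewrite -subr_eq0 e12.
Qed.

End NoncommutativeNormalisation.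

Ltac nc_mem x l :=
  lazymatch l with
  | nil => constr:(false)
  | x :: _ => constr:(true)
  | _ :: ?l' => nc_mem x l'
  end.

Ltac nc_add x l :=
  let b := nc_mem x l in
  lazymatch b with true => l | false => constr:(x :: l) end.

Ltac nc_index x l :=
  lazymatch l with
  | x :: _ => constr:(0%N)
  | _ :: ?l' => let n := nc_index x l' in constr:(S n)
  end.

Ltac nc_atoms x l :=
  lazymatch x with
  | @uone _ _ => l
  | 0%R => l
  | (?a + ?b)%R => let l1 := nc_atoms a l in nc_atoms b l1
  | (- ?a)%R => nc_atoms a l
  | (?a ** ?b)%R => let l1 := nc_atoms a l in nc_atoms b l1
  | (_ *: ?a)%R => nc_atoms a l
  | _ => nc_add x l
  end.

Ltac nc_reify K x l :=
  lazymatch x with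
  | @uone _ _ => constr:(@NcOne K)
  | 0%R => constr:(@NcZero K)
  | (?a + ?b)%R =>
    let e1 := nc_reify K a l in let e2 := nc_reify K b l in constr:(@NcAdd K e1 e2)
  | (- ?a)%R => let e1 := nc_reify K a l in constr:(@NcOpp K e1)
  | (?a ** ?b)%R =>
    let e1 := nc_reify K a l in let e2 := nc_reify K b l in constr:(@NcMul K e1 e2)
  | (?c *: ?a)%R => let e1 := nc_reify K a l in constr:(@NcScale K c e1)
  | _ => let n := nc_index x l in constr:(@NcAtom K n)
  end.

Ltac nc_tac A :=
  lazymatch type of A with
  | unital_cstar ?R =>
  lazymatch goal with
  | |- ?x = ?y =>
    let T := type of x in
    let l0 := nc_atoms x (@nil T) in
    let l := nc_atoms y l0 in
    let K := constr:(complex (Real.sort R)) in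
    let e1 := nc_reify K x l in
    let e2 := nc_reify K y l in
    apply: (@nc_eqP R A l e1 e2);
    cbv [nc_eq ncp_of ncp_null ncp_coef ncp_drop ncp_mul ncp_mulm ncp_cat
         word_cat word_eq word_letter_eq]
  end end.

Ltac nc A := nc_tac A; repeat (split; [first [ring | field]|]); try by [].

(** * Positive elements *)

Section Positivity.
Context (R : realType) (A : unital_cstar R).
Implicit Types (x y h k g r : A) (s t m : R).

Lemma adjN (B : cstarAlgType R) (x : B) : adj (- x) = - adj x.
Proof. by apply: (addrI (adj x)); rewrite -adjD !subrr adj0. Qed.

Lemma adjB (B : cstarAlgType R) (x y : B) : adj (x - y) = adj x - adj y.
Proof. by rewrite adjD adjN. Qed.

Lemma adjZr (B : cstarAlgType R) t (x : B) : adj (t%:C *: x) = t%:C *: adj x.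
Proof. by rewrite adjZ conjc_real. Qed.

Lemma conjc_i : conjc 'i%C = - 'i%C :> R[i].
Proof. by apply/eqP; rewrite eq_complex /= oppr0 !eqxx. Qed.

Lemma adj_uone : adj (uone : A) = uone.
Proof. by rewrite -[LHS]amul_uone -[in RHS](adjK uone) -{2}[adj uone]amul_uone adjM adjK. Qed.

Lemma rnorm_uone : rnorm (uone : A) <= 1.
Proof.
have := rnorm_sa adj_uone; rewrite uone_amul => e2.
by have := rnorm_ge0 (uone : A); nra.
Qed.

Lemma rnorm_scalar t : 0 <= t -> rnorm (t%:C *: (uone : A)) <= t.
Proof.
by move=> t0; rewrite rnormZr ger0_norm // ler_piMr // rnorm_uone.
Qed.

Lemma rnorm_limit x m :
  (forall e, 0 < e -> exists2 y, rnorm y <= m & rnorm (x - y) <= e) -> rnorm x <= m.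
Proof.
move=> H; apply/ler_addgt0Pr => e e0; have [y ym xy] := H e e0.
by rewrite -(subrK y x); apply: le_trans (rnormD _ _) _; lra.
Qed.

Lemma rnorm_smallM (B : cstarAlgType R) (x : B) m :
  (forall e, 0 < e -> rnorm x <= m * e) -> x = 0.
Proof.
move=> H; apply: rnorm_small => e e0.
have m0 : 0 < `|m| + 1 by have := normr_ge0 m; lra.
apply: le_trans (H (e / (`|m| + 1)) _) _; first exact: divr_gt0.
rewrite mulrCA -[leRHS]mulr1 ler_pM2l // ler_pdivrMr // mul1r.
by have := ler_norm m; lra.
Qed.

(** Here c is 1 - sqrt (1 - k), the limit of the iteration c |-> (k + c^2) / 2 from
0. Its coefficients are nonnegative, so the iteration in the reals with 1 in
place of k dominates it; as that one increases and stays below 1, norm 1 is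
allowed for k. *)
Lemma contraction_fixpoint k : adj k = k -> rnorm k <= 1 ->
  exists c, [/\ adj c = c, rnorm c <= 1, c + c = k + c ** c
    & forall x, x ** k = k ** x -> x ** c = c ** x].
Proof.
move=> ks k1.
pose c_ := fix c_ n : A := if n is n'.+1 then (2^-1)%:C *: (k + c_ n' ** c_ n') else 0.
pose q_ := fix q_ n : R := if n is n'.+1 then 2^-1 * (1 + q_ n' ^+ 2) else 0.
have q01 n : 0 <= q_ n <= 1.
  by elim: n => [|n /andP[a b]] /=; [rewrite lexx ler01|apply/andP; split; nra].
have cq n : rnorm (c_ n) <= q_ n.
  elim: n => [|n IH] /=; first by rewrite rnorm0.
  rewrite rnormZr ger0_norm ?invr_ge0 // ler_pM2l ?invr_gt0 //.
  apply: le_trans (rnormD _ _) _; have := rnormM (c_ n) (c_ n).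
  by have := rnorm_ge0 (c_ n); nra.
have cs n : adj (c_ n) = c_ n.
  by elim: n => [|n IH] /=; rewrite ?adj0 // adjZr adjD adjM ks IH.
have cc n x : x ** k = k ** x -> x ** c_ n = c_ n ** x.
  move=> xk; elim: n => [|n IH] /=; first by rewrite amul0l amul0r.
  by rewrite amulZl amulZr amulDl amulDr xk amulA IH -!amulA IH.
have dcq n : rnorm (c_ n.+1 - c_ n) <= q_ n.+1 - q_ n.
  elim: n => [|n IH].
    rewrite /= amul0l addr0 !subr0 rnormZr ger0_norm ?invr_ge0 //.
    by rewrite expr0n addr0 ler_pM2l ?invr_gt0.
  have -> : c_ n.+2 - c_ n.+1 = (2^-1)%:C *:
      (c_ n.+1 ** (c_ n.+1 - c_ n) + (c_ n.+1 - c_ n) ** c_ n).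
    transitivity ((2^-1)%:C *: (k + c_ n.+1 ** c_ n.+1) -
      (2^-1)%:C *: (k + c_ n ** c_ n)); first by [].
    by move: (c_ n.+1) (c_ n) => u v; nc A.
  rewrite rnormZr ger0_norm ?invr_ge0 //.
  have -> : q_ n.+2 - q_ n.+1 = 2^-1 * (q_ n.+1 - q_ n) * (q_ n.+1 + q_ n).
    transitivity (2^-1 * (1 + q_ n.+1 ^+ 2) - 2^-1 * (1 + q_ n ^+ 2)); first by [].
    by move: (q_ n.+1) (q_ n) => a b; ring.
  rewrite -mulrA ler_pM2l ?invr_gt0 // mulrDr.
  apply: le_trans (rnormD _ _) _.
  apply: lerD; apply: le_trans (rnormM _ _) _; first rewrite mulrC.
    by apply: ler_pM; rewrite ?rnorm_ge0.
  by apply: ler_pM; rewrite ?rnorm_ge0.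
have [|l lP] := @dominated_increments_cvg R A c_ q_ 1 _ dcq.
  by move=> n; have /andP[] := q01 n.
have lim e : 0 < e -> exists n, rnorm (l - c_ n) <= e /\ rnorm (l - c_ n.+1) <= e.
  move=> e0; have [N NP] := lP e e0.
  by exists N; split; apply/ltW/NP.
have l1 : rnorm l <= 1.
  apply: rnorm_limit => e /lim[n [ln _]]; exists (c_ n) => //.
  by apply: le_trans (cq n) _; have /andP[] := q01 n.
exists l; split => //.
- apply/eqP; rewrite -subr_eq0; apply/eqP.
  apply: (@rnorm_smallM _ _ 2) => e /lim[n [ln _]].
  have -> : adj l - l = adj (l - c_ n) - (l - c_ n) by rewrite adjB cs; nc A.
  by apply: le_trans (rnormB _ _) _; rewrite rnorm_adj; lra.
- apply/eqP; rewrite -subr_eq0; apply/eqP.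
  apply: (@rnorm_smallM _ _ 4) => e /lim[n [ln ln1]].
  have -> : l + l - (k + l ** l) = (l - c_ n.+1) + (l - c_ n.+1) -
      (l ** (l - c_ n) + (l - c_ n) ** c_ n).
    by rewrite /= -/(c_ n); move: (c_ n) => u; nc A.
  apply: le_trans (rnormB _ _) _.
  have cn1 : rnorm (c_ n) <= 1 by apply: le_trans (cq n) _; have /andP[] := q01 n.
  have e1 : rnorm (l ** (l - c_ n)) <= 1 * e.
    by apply: le_trans (rnormM _ _) _; apply: ler_pM; rewrite ?rnorm_ge0.
  have e2 : rnorm ((l - c_ n) ** c_ n) <= e * 1.
    by apply: le_trans (rnormM _ _) _; apply: ler_pM; rewrite ?rnorm_ge0.
  have := rnormD (l - c_ n.+1) (l - c_ n.+1).
  by have := rnormD (l ** (l - c_ n)) ((l - c_ n) ** c_ n); lra.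
- move=> x xk; apply/eqP; rewrite -subr_eq0; apply/eqP.
  apply: (@rnorm_smallM _ _ (2 * rnorm x)) => e /lim[n [ln _]].
  have -> : x ** l - l ** x = x ** (l - c_ n) - (l - c_ n) ** x.
    have xu := cc n x xk; move: (c_ n) xu => u xu.
    transitivity (x ** l - l ** x - (x ** u - u ** x)); last nc A.
    by rewrite xu subrr subr0.
  apply: le_trans (rnormB _ _) _.
  have e1 : rnorm (x ** (l - c_ n)) <= rnorm x * e.
    by apply: le_trans (rnormM _ _) _; rewrite ler_wpM2l ?rnorm_ge0.
  have e2 : rnorm ((l - c_ n) ** x) <= e * rnorm x.
    by apply: le_trans (rnormM _ _) _; rewrite ler_wpM2r ?rnorm_ge0.
  by lra.
Qed.

(** Positivity is expressed by the norm alone, which makes the positive elements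
visibly a cone; [pos_sqrt] and [pos_adjmul] identify it with the squares of
self-adjoint elements and with the elements x^* x. *)
Definition pos h :=
  adj h = h /\ exists2 t, 0 <= t & rnorm (t%:C *: uone - h) <= t.

Lemma pos_scalar_sub m k : adj k = k -> rnorm k <= m -> pos (m%:C *: uone - k).
Proof.
move=> ks km; split; first by rewrite adjB adjZr adj_uone ks.
by exists m; [exact: le_trans (rnorm_ge0 _) km|rewrite subKr].
Qed.

Lemma pos_scalar_add m k : adj k = k -> rnorm k <= m -> pos (m%:C *: uone + k).
Proof.
move=> ks km; rewrite -[k]opprK; apply: pos_scalar_sub; rewrite ?rnormN //.
by rewrite adjN ks.
Qed.

Lemma pos_scalar m : 0 <= m -> pos (m%:C *: uone).
Proof.
by move=> m0; rewrite -[_ *: _]subr0; apply: pos_scalar_sub; rewrite ?adj0 ?rnorm0.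
Qed.

Lemma posD h k : pos h -> pos k -> pos (h + k).
Proof.
move=> [hs [s s0 hn]] [ks [t t0 kn]]; split; first by rewrite adjD hs ks.
exists (s + t); first exact: addr_ge0.
have -> : (s + t)%:C *: uone - (h + k) = (s%:C *: uone - h) + (t%:C *: uone - k).
  by nc A.
by apply: le_trans (rnormD _ _) _; exact: lerD.
Qed.

Lemma posZ m h : 0 <= m -> pos h -> pos (m%:C *: h).
Proof.
move=> m0 [hs [t t0 hn]]; split; first by rewrite adjZr hs.
exists (m * t); first exact: mulr_ge0.
have -> : (m * t)%:C *: uone - m%:C *: h = m%:C *: (t%:C *: uone - h) by nc A.
by rewrite rnormZr ger0_norm // ler_wpM2l.
Qed.

Lemma pos_sqrt h : pos h -> exists r,
  [/\ pos r, r ** r = h & forall x, x ** h = h ** x -> x ** r = r ** x].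
Proof.
move=> [hs [t t0 ht]].
pose s := Num.sqrt (t + 1).
have s0 : 0 < s by rewrite sqrtr_gt0; lra.
have ss : s * s = t + 1 by rewrite -expr2 sqr_sqrtr //; lra.
have ss0 : s * s != 0 by rewrite mulf_neq0 // gt_eqF.
pose k := (s * s)^-1%:C *: ((s * s)%:C *: uone - h).
have hk : h = (s * s)%:C *: (uone - k).
  by rewrite scalerBr scalerA -rmorphM mulfV // scale1r subKr.
have ks : adj k = k by rewrite adjZr adjB adjZr adj_uone hs.
have k1 : rnorm k <= 1.
  rewrite rnormZr normfV ger0_norm ?mulr_ge0 ?(ltW s0) //.
  rewrite mulrC ler_pdivrMr ?mulr_gt0 // mul1r ss.
  have -> : (t + 1)%:C *: uone - h = (t%:C *: uone - h) + 1%:C *: uone by nc A.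
  apply: le_trans (rnormD _ _) _; have := @rnorm_scalar 1 ler01.
  by lra.
have [c [cs c1 cc comm]] := contraction_fixpoint ks k1.
exists (s%:C *: (uone - c)); split.
- split; first by rewrite adjZr adjB adj_uone cs.
  exists s; first exact: ltW.
  have -> : s%:C *: uone - s%:C *: (uone - c) = s%:C *: c by nc A.
  by rewrite rnormZr gtr0_norm // ler_piMr // ltW.
- rewrite [RHS]hk.
  transitivity ((s * s)%:C *: (uone - (c + c) + c ** c)); first by nc A.
  by rewrite cc; nc A.
- move=> x xh; have xk : x ** k = k ** x.
    rewrite /k amulZl amulZr amulDl amulDr.
    by congr (_ *: _); rewrite -[- h]scaleN1r !(amulZl, amulZr) xh; nc A.
  move/comm: xk => xc; transitivity (s%:C *: (x - x ** c)); first by nc A.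
  by rewrite xc; nc A.
Qed.

(** Here h + i k is a multiple of a unitary element. *)
Lemma norm_le_sum_squares h k s : adj h = h -> adj k = k -> h ** k = k ** h ->
  0 <= s -> h ** h + k ** k = (s ^+ 2)%:C *: uone -> rnorm h <= s.
Proof.
move=> hs ks hk s0 hhkk; pose u := h + 'i%C *: k.
have us : adj u = h - 'i%C *: k.
  rewrite adjD adjZ hs ks.
  by rewrite conjc_i scaleNr.
have uu : adj u ** u = (s ^+ 2)%:C *: uone.
  rewrite us -hhkk.
  transitivity (h ** h - ('i%C * 'i%C) *: (k ** k) + 'i%C *: (h ** k - k ** h)).
    by rewrite /u; nc A.
  by rewrite -expr2 sqr_i hk subrr scaler0 addr0 scaleN1r opprK.
have u_le : rnorm u <= s.
  have := rnorm_cstar u; rewrite uu => un.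
  have := @rnorm_scalar (s ^+ 2) (sqr_ge0 s); rewrite un.
  by rewrite ler_sqr // nnegrE rnorm_ge0.
have -> : h = (2^-1)%:C *: (u + adj u).
  by rewrite us /u; move: ('i%C *: k) => ik; nc A.
rewrite rnormZr ger0_norm ?invr_ge0 //.
have := rnormD u (adj u); rewrite rnorm_adj; lra.
Qed.

Lemma pos_square k : adj k = k -> pos (k ** k).
Proof.
move=> ks; pose m := rnorm k.
have kks : adj (k ** k) = k ** k by rewrite adjM ks.
have kkm : rnorm (k ** k) <= m ^+ 2 by rewrite rnorm_sa.
have [r [[rs _] rr comm]] := pos_sqrt (pos_scalar_sub kks kkm).
have rk : k ** r = r ** k by apply: comm; nc A.
split=> //; exists (m ^+ 2); first exact: sqr_ge0.
rewrite -rr rnorm_sa // ler_sqr ?nnegrE ?rnorm_ge0 //.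
apply: (norm_le_sum_squares rs ks) => //; first exact: rnorm_ge0.
by rewrite rr subrK.
Qed.

(** If s - g = c^2 and s + g = d^2, then g^2 + (c d)^2 = s^2. *)
Lemma norm_le_pos g s : 0 <= s -> adj g = g ->
  pos (s%:C *: uone - g) -> pos (s%:C *: uone + g) -> rnorm g <= s.
Proof.
move=> s0 gs /pos_sqrt[c [[cs _] cc ccomm]] /pos_sqrt[d [[ds _] dd dcomm]].
have gc : g ** c = c ** g by apply: ccomm; nc A.
have gd : g ** d = d ** g by apply: dcomm; nc A.
have cd : c ** d = d ** c.
  apply: dcomm; transitivity (s%:C *: c + c ** g); first by nc A.
  by rewrite -gc; nc A.
apply: (@norm_le_sum_squares g (c ** d)) => //.
- by rewrite adjM cs ds cd.
- by rewrite amulA gc -!amulA gd.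
- rewrite -amulA (amulA d) -cd -amulA dd amulA cc; nc A.
Qed.

(** The elements v^* v and v v^* are related by v^* f(v v^* ) v = f(v^* v) v^* v.
If v^* v is at most s then v v^* is at least - s, as the sum of the two is a sum of
squares; so nu - v v^* has norm at most nu + s, where nu = |v|^2, and the relation for
f(z) = nu - z bounds the norm of (nu - v^* v) v^* v by nu (nu + s). Completing
the square, this bounds - v^* v from above, by less than nu if s < nu; as v^* v is
at most s < nu too, its norm would then be less than nu. *)
Lemma norm_le_adjmul v s : 0 <= s ->
  pos (s%:C *: uone - adj v ** v) -> rnorm v ^+ 2 <= s.
Proof.
move=> s0 ps; rewrite leNgt; apply/negP => snu.
pose nu := rnorm v ^+ 2; rewrite -/nu in snu.
pose p := adj v ** v; pose p' := v ** adj v.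
have psa : adj p = p by rewrite adjM adjK.
have psa' : adj p' = p' by rewrite adjM adjK.
have pn : rnorm p = nu by rewrite rnorm_cstar.
have pn' : rnorm p' = nu by rewrite /p' -{1}(adjK v) rnorm_cstar rnorm_adj.
have pos_p' : pos (s%:C *: uone + p').
  pose h := v + adj v; pose k := 'i%C *: (v - adj v).
  have hsa : adj h = h by rewrite adjD adjK addrC.
  have ksa : adj k = k.
    rewrite adjZ adjB adjK.
    by rewrite conjc_i /k; nc A.
  have -> : s%:C *: uone + p' = (s%:C *: uone - p) + (2^-1)%:C *: (h ** h + k ** k).
    transitivity ((s%:C *: uone - p) + (2^-1)%:C *:
        (h ** h + ('i%C * 'i%C) *: ((v - adj v) ** (v - adj v)))).
      by rewrite -expr2 sqr_i /p /p' /h; nc A.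
    by rewrite /k; nc A.
  apply: posD => //; apply: posZ; first by rewrite invr_ge0.
  by apply: posD; exact: pos_square.
pose B := nu%:C *: uone - p'.
have Bsa : adj B = B by rewrite adjB adjZr adj_uone psa'.
have Bn : rnorm B <= nu + s.
  have nu0 : 0 <= nu by exact: sqr_ge0.
  apply: norm_le_pos => //; first exact: addr_ge0.
    by have -> : (nu + s)%:C *: uone - B = s%:C *: uone + p' by rewrite /B; nc A.
  apply: posD; first by apply: pos_scalar; exact: addr_ge0.
  by apply: pos_scalar_sub; rewrite ?pn'.
pose k := (nu / 2)%:C *: uone - p.
have ksa : adj k = k by rewrite adjB adjZr adj_uone psa.
have kn : rnorm k ^+ 2 <= (nu / 2) ^+ 2 + nu * (nu + s).
  rewrite -rnorm_sa //.
  have -> : k ** k = ((nu / 2) ^+ 2)%:C *: uone - adj v ** B ** v.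
    by rewrite /k /B /p /p'; nc A.
  apply: le_trans (rnormB _ _) _; apply: lerD; first exact/rnorm_scalar/sqr_ge0.
  apply: le_trans (rnormM _ _) _.
  apply: le_trans (ler_wpM2r (rnorm_ge0 _) (rnormM _ _)) _.
  by rewrite rnorm_adj mulrAC -expr2 ler_wpM2l ?sqr_ge0.
pose m := rnorm k; pose s' := Num.max (m - nu / 2) s.
have : rnorm p <= s'.
  apply: norm_le_pos => //; first by rewrite le_max s0 orbT.
    have -> : s'%:C *: uone - p = (s' - s)%:C *: uone + (s%:C *: uone - p) by nc A.
    by apply: posD => //; apply: pos_scalar; rewrite subr_ge0 le_max lexx orbT.
  have -> : s'%:C *: uone + p = (s' - (m - nu / 2))%:C *: uone + (m%:C *: uone - k).
    by rewrite /k; nc A.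
  apply: posD; last exact: pos_scalar_sub.
  by apply: pos_scalar; rewrite subr_ge0 le_max lexx.
rewrite pn leNgt gt_max snu andbT => /negP; apply.
have m0 : 0 <= m by exact: rnorm_ge0.
by move: kn; rewrite -/m; nra.
Qed.

(** If h = x^* x were not equal to k = |h|, then y = x (k - h) would be nonzero
although - y^* y = k (k - h)^2 is positive. *)
Theorem pos_adjmul x : pos (adj x ** x).
Proof.
pose h := adj x ** x; have hsa : adj h = h by rewrite adjM adjK.
have [k [kpos kk kcomm]] := pos_sqrt (pos_square hsa).
have hk : h ** k = k ** h by apply: kcomm; rewrite amulA.
have [r [[rsa _] rr rcomm]] := pos_sqrt kpos.
pose d := k - h; pose y := x ** d.
have dsa : adj d = d by rewrite adjB hsa kpos.1.
have rd : r ** d = d ** r.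
  have rk := rcomm k erefl; have rh := rcomm h hk.
  by transitivity (k ** r - h ** r); [rewrite rk rh /d|rewrite /d]; nc A.
have kd : k ** d = d ** k.
  by transitivity (k ** k - k ** h); [|rewrite -hk]; rewrite /d; nc A.
have hd : h ** d = - (k ** d).
  by transitivity (k ** h - k ** k); [rewrite -hk kk|]; rewrite /d; nc A.
have rdsa : adj (r ** d) = r ** d by rewrite adjM rsa dsa rd.
have yy : adj y ** y = - ((r ** d) ** (r ** d)).
  rewrite /y adjM dsa -amulA (amulA (adj x)) -/h hd.
  rewrite -amulA (amulA d) -rd -amulA (amulA r r) rr.
  by transitivity (- (d ** k ** d)); [|rewrite -kd]; nc A.
have y0 : rnorm y ^+ 2 <= 0.
  apply: norm_le_adjmul => //.
  by rewrite scale0r yy opprK add0r; exact: pos_square.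
have rd0 : r ** d = 0.
  apply/rnorm_eq0/eqP; rewrite -sqrf_eq0 -rnorm_sa // -rnormN -yy rnorm_cstar.
  by rewrite eq_le y0 sqr_ge0.
have kd0 : k ** d = 0 by rewrite -rr -amulA rd0 amul0r.
have d0 : d = 0.
  apply/rnorm_eq0/eqP; rewrite -sqrf_eq0 -rnorm_sa //.
  have -> : d ** d = k ** d - h ** d by rewrite {1}/d; nc A.
  by rewrite hd kd0 oppr0 subr0 rnorm0.
by rewrite -/h (_ : h = k) //; apply/eqP; rewrite eq_sym -subr_eq0 -/d d0.
Qed.

Lemma pos_adjmulE h : pos h -> exists y, h = adj y ** y.
Proof. by move=> /pos_sqrt[r [[rsa _] <- _]]; exists r; rewrite rsa. Qed.

Lemma pos_conj h x : pos h -> pos (adj x ** h ** x).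
Proof.
move=> /pos_adjmulE[y ->].
by rewrite -amulA -(amulA (adj y)) amulA -adjM; exact: pos_adjmul.
Qed.

Lemma pos_norm_le h k : pos h -> pos (k - h) -> rnorm h <= rnorm k.
Proof.
move=> hp khp; have ksa : adj k = k by rewrite -(subrK h k) adjD khp.1 hp.1.
apply: norm_le_pos; rewrite ?rnorm_ge0 ?hp.1 //.
  have -> : (rnorm k)%:C *: uone - h = ((rnorm k)%:C *: uone - k) + (k - h) by nc A.
  by apply: posD => //; exact: pos_scalar_sub.
by apply: posD => //; apply: pos_scalar; exact: rnorm_ge0.
Qed.

End Positivity.

(** For self-adjoint a of norm t, positivity of t + a and of t - a bounds S a by
t S 1; the factor 2 comes from the real and imaginary parts. *)
Theorem positive_map_bounded (R : realType) (A B : unital_cstar R)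
    (S : {linear A -> B}) :
  (forall x, exists y, S (adj x ** x) = adj y ** y) ->
  forall x, rnorm (S x) <= 2 * rnorm (S uone) * rnorm x.
Proof.
move=> Spos; have Sp a : pos a -> pos (S a).
  by move=> /pos_adjmulE[x ->]; have [y ->] := Spos x; exact: pos_adjmul.
pose m := rnorm (S uone); have m0 : 0 <= m by exact: rnorm_ge0.
have Ssa a : adj a = a -> rnorm (S a) <= m * rnorm a.
  move=> asa; pose t := rnorm a; have t0 : 0 <= t by exact: rnorm_ge0.
  have p1 : pos (S uone) by apply: Sp; rewrite -[uone]scale1r; exact: pos_scalar.
  have pm : pos ((t * m)%:C *: uone - t%:C *: S uone).
    have -> : (t * m)%:C *: uone - t%:C *: S uone = t%:C *: (m%:C *: uone - S uone).
      by nc B.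
    by apply: posZ => //; apply: pos_scalar_sub => //; exact: p1.1.
  have pmin : pos (t%:C *: S uone - S a).
    by rewrite -linearZ -raddfB; apply: Sp; exact: pos_scalar_sub.
  have padd : pos (t%:C *: S uone + S a).
    by rewrite -linearZ -raddfD; apply: Sp; exact: pos_scalar_add.
  have Sasa : adj (S a) = S a.
    have -> : S a = (t%:C *: S uone + S a) - t%:C *: S uone by rewrite addrC addKr.
    by rewrite adjB padd.1 adjZr p1.1.
  rewrite mulrC; apply: norm_le_pos; rewrite ?mulr_ge0 //.
    have -> : (t * m)%:C *: uone - S a =
      ((t * m)%:C *: uone - t%:C *: S uone) + (t%:C *: S uone - S a) by nc B.
    exact: posD.
  have -> : (t * m)%:C *: uone + S a =
    ((t * m)%:C *: uone - t%:C *: S uone) + (t%:C *: S uone + S a) by nc B.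
  exact: posD.
move=> x; pose h := x + adj x; pose k := 'i%C *: (x - adj x).
have hsa : adj h = h by rewrite adjD adjK addrC.
have ksa : adj k = k.
  rewrite adjZ adjB adjK.
  by rewrite conjc_i /k; nc A.
have Sx : S x = (2^-1)%:C *: (S h - 'i%C *: S k).
  rewrite -linearZ -raddfB -linearZ; congr (S _).
  transitivity ((2^-1)%:C *: (h - ('i%C * 'i%C) *: (x - adj x))).
    by rewrite -expr2 sqr_i /h; nc A.
  by rewrite /k; nc A.
rewrite Sx rnormZr ger0_norm ?invr_ge0 //.
have := rnormB (S h) ('i%C *: S k); rewrite rnormZi.
have := Ssa h hsa; have := Ssa k ksa; rewrite rnormZi -/m.
have := rnormD x (adj x); have := rnormB x (adj x); rewrite rnorm_adj -/h => h1 h2 h3 h4 h5.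
have h6 : m * rnorm (x - adj x) <= m * (rnorm x + rnorm x) by rewrite ler_wpM2l.
have h7 : m * rnorm h <= m * (rnorm x + rnorm x) by rewrite ler_wpM2l.
by lra.
Qed.

(** * The Hilbert module A^n *)

Section HilbertModule.
Context (R : realType) (A : unital_cstar R) (n : nat).
Implicit Types (xi eta zeta : 'I_n -> A) (a : A) (t : R).

Definition ip xi eta : A := \sum_i adj (xi i) ** eta i.

Definition hnorm xi : R := Num.sqrt (rnorm (ip xi xi)).

Lemma ip_adj xi eta : adj (ip xi eta) = ip eta xi.
Proof. by rewrite adj_sum; apply: eq_bigr => i _; rewrite adjM adjK. Qed.

Lemma ipDr xi eta zeta : ip xi (eta + zeta) = ip xi eta + ip xi zeta.
Proof. by rewrite -big_split; apply: eq_bigr => i _; exact: amulDr. Qed.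

Lemma ipDl xi eta zeta : ip (eta + zeta) xi = ip eta xi + ip zeta xi.
Proof. by rewrite -ip_adj ipDr adjD !ip_adj. Qed.

Lemma ipMr xi eta a : ip xi (fun i => eta i ** a) = ip xi eta ** a.
Proof. by rewrite amul_suml; apply: eq_bigr => i _; rewrite amulA. Qed.

Lemma ipMl xi eta a : ip (fun i => xi i ** a) eta = adj a ** ip xi eta.
Proof. by rewrite -ip_adj ipMr adjM ip_adj. Qed.

Lemma ipZr (c : R[i]) xi eta : ip xi (c *: eta) = c *: ip xi eta.
Proof. by rewrite scaler_sumr; apply: eq_bigr => i _; exact: amulZr. Qed.

Lemma ipZl (c : R[i]) xi eta : ip (c *: xi) eta = conjc c *: ip xi eta.
Proof. by rewrite -ip_adj ipZr adjZ ip_adj. Qed.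

Lemma pos_sum (I : Type) (r : seq I) (P : pred I) (F : I -> A) :
  (forall i, pos (F i)) -> pos (\sum_(i <- r | P i) F i).
Proof.
move=> Fp; apply: (big_ind (@pos R A)) => //; last exact: posD.
by rewrite -(scale0r uone); exact: pos_scalar.
Qed.

Lemma pos_ip xi : pos (ip xi xi).
Proof. by apply: pos_sum => i; exact: pos_adjmul. Qed.

Lemma hnorm_ge0 xi : 0 <= hnorm xi.
Proof. exact: sqrtr_ge0. Qed.

Lemma hnorm_sq xi : hnorm xi ^+ 2 = rnorm (ip xi xi).
Proof. by rewrite sqr_sqrtr // rnorm_ge0. Qed.

Lemma hnorm_le xi t : 0 <= t -> rnorm (ip xi xi) <= t ^+ 2 -> hnorm xi <= t.
Proof. by move=> t0; rewrite -hnorm_sq ler_sqr // nnegrE hnorm_ge0. Qed.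

Lemma rnorm_entry_le xi i : rnorm (xi i) <= hnorm xi.
Proof.
rewrite -ler_sqr ?nnegrE ?hnorm_ge0 ?rnorm_ge0 // hnorm_sq -rnorm_cstar.
apply: pos_norm_le; first exact: pos_adjmul.
rewrite /ip (bigD1 i) //= addrAC subrr add0r.
by apply: pos_sum => j; exact: pos_adjmul.
Qed.

Lemma rnorm_sum (I : Type) (r : seq I) (F : I -> A) :
  rnorm (\sum_(i <- r) F i) <= \sum_(i <- r) rnorm (F i).
Proof.
elim/big_ind2: _ => [|x s y t xs yt|//]; first by rewrite rnorm0.
by apply: le_trans (rnormD _ _) _; exact: lerD.
Qed.

Lemma hnorm_le_sum xi : hnorm xi <= \sum_i rnorm (xi i).
Proof.
have S0 : 0 <= \sum_i rnorm (xi i) by apply: sumr_ge0 => i _; exact: rnorm_ge0.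
apply: hnorm_le => //; apply: le_trans (rnorm_sum _ _) _.
rewrite expr2 mulr_sumr; apply: ler_sum => i _.
rewrite rnorm_cstar expr2 ler_wpM2r ?rnorm_ge0 // (bigD1 i) //= lerDl.
by apply: sumr_ge0 => j _; exact: rnorm_ge0.
Qed.

(** The inner product of t eta - xi <xi, eta> with itself is positive for
t = |xi|^2. *)
Lemma cauchy_schwarz xi eta : rnorm (ip xi eta) <= hnorm xi * hnorm eta.
Proof.
pose t := hnorm xi ^+ 2; pose a := ip xi eta.
have [xi0|xi0] := eqVneq (hnorm xi) 0.
  have -> : ip xi eta = 0.
    rewrite /ip big1 // => i _.
    have -> : xi i = 0; last by rewrite adj0 amul0l.
    apply/rnorm_eq0/eqP; rewrite eq_le rnorm_ge0 andbT.
    by rewrite -xi0 rnorm_entry_le.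
  by rewrite rnorm0 mulr_ge0 ?hnorm_ge0.
have t0 : 0 < t by rewrite exprn_gt0 // lt_def xi0 hnorm_ge0.
have pt : pos (t%:C *: uone - ip xi xi).
  by apply: pos_scalar_sub; [rewrite ip_adj|rewrite /t hnorm_sq].
have p1 := pos_ip (t%:C *: eta + (fun i => xi i ** - a)).
have p2 : pos ((t ^+ 2)%:C *: ip eta eta - t%:C *: (adj a ** a)).
  have := posD p1 (pos_conj a pt); set L := _ + _.
  suff -> : L = (t ^+ 2)%:C *: ip eta eta - t%:C *: (adj a ** a) by [].
  rewrite /L !ipDr !ipDl ipMr !ipMl ipMr !ipZr !ipZl conjc_real adjN.
  rewrite -(ip_adj xi eta) -/a; move: (ip xi xi) (ip eta eta) => b c.
  by nc A.
have := pos_norm_le (posZ (ltW t0) (pos_adjmul a)) p2.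
rewrite !rnormZr !ger0_norm ?(ltW t0) ?sqr_ge0 // rnorm_cstar.
have -> : t ^+ 2 * rnorm (ip eta eta) = t * (t * hnorm eta ^+ 2).
  by rewrite hnorm_sq mulrA.
rewrite ler_pM2l // -exprMn ler_sqr // nnegrE ?rnorm_ge0 //.
by rewrite mulr_ge0 ?hnorm_ge0.
Qed.

Lemma hnormD xi eta : hnorm (xi + eta) <= hnorm xi + hnorm eta.
Proof.
apply: hnorm_le; first by rewrite addr_ge0 ?hnorm_ge0.
rewrite ipDr !ipDl; have c1 := cauchy_schwarz xi eta; have c2 := cauchy_schwarz eta xi.
have := rnormD (ip xi xi + ip eta xi) (ip xi eta + ip eta eta).
have := rnormD (ip xi xi) (ip eta xi); have := rnormD (ip xi eta) (ip eta eta).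
rewrite -!hnorm_sq; nra.
Qed.

Lemma hnormZ (c : R[i]) xi : hnorm (c *: xi) = complex.Re `|c| * hnorm xi.
Proof.
have c0 := Re_norm_ge0 c.
rewrite /hnorm ipZl ipZr scalerA rnormZ normrM normcJ -expr2.
have -> : `|c| = (complex.Re `|c|)%:C by rewrite RRe_real // normr_real.
by rewrite -rmorphXn /= sqrtrM ?sqr_ge0 // sqrtr_sqr ger0_norm.
Qed.

End HilbertModule.

(** * Matrices over a unital C*-algebra *)

Section CStarMatrices.
Context (R : realType) (A : unital_cstar R) (n : nat).

(** As functions with values in A, matrices are a module over the complex numbers. *)
Definition cstar_mx : Type := 'I_n -> 'I_n -> A.

HB.instance Definition _ := GRing.Lmodule.copy cstar_mx ('I_n -> 'I_n -> A).

Implicit Types (X Y Z : cstar_mx) (xi eta : 'I_n -> A).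

Definition cmx_mul X Y : cstar_mx := fun i j => \sum_k X i k ** Y k j.
Definition cmx_adj X : cstar_mx := fun i j => adj (X j i).
Definition cmx_act X xi : 'I_n -> A := fun i => \sum_j X i j ** xi j.
Definition cmx_one : cstar_mx := fun i j => if i == j then uone else 0.

Lemma cmxP X Y : (forall i j, X i j = Y i j) -> X = Y.
Proof. by move=> XY; apply/funext => i; apply/funext => j. Qed.

Lemma cmxDE X Y i j : (X + Y) i j = X i j + Y i j.
Proof. by []. Qed.

Lemma cmx_sumE (I : Type) (r : seq I) (F : I -> cstar_mx) i j :
  (\sum_(l <- r) F l) i j = \sum_(l <- r) F l i j.
Proof. by elim/big_rec2: _ => // l y x _ <-. Qed.

Lemma cmx_mulA : associative cmx_mul.
Proof.
move=> X Y Z; apply: cmxP => i j; rewrite /cmx_mul.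
under eq_bigr do rewrite amul_sumr; rewrite exchange_big /=.
by apply: eq_bigr => k _; rewrite amul_suml; apply: eq_bigr => l _; rewrite amulA.
Qed.

Lemma cmx_mulDl : left_distributive cmx_mul +%R.
Proof.
move=> X Y Z; apply: cmxP => i j; rewrite cmxDE /cmx_mul -big_split.
by apply: eq_bigr => k _; exact: amulDl.
Qed.

Lemma cmx_mulDr : right_distributive cmx_mul +%R.
Proof.
move=> X Y Z; apply: cmxP => i j; rewrite cmxDE /cmx_mul -big_split.
by apply: eq_bigr => k _; exact: amulDr.
Qed.

Lemma cmx_mulZl (c : R[i]) X Y : cmx_mul (c *: X) Y = c *: cmx_mul X Y.
Proof.
apply: cmxP => i j; rewrite [RHS]scaler_sumr.
by apply: eq_bigr => k _; exact: amulZl.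
Qed.

Lemma cmx_mulZr (c : R[i]) X Y : cmx_mul X (c *: Y) = c *: cmx_mul X Y.
Proof.
apply: cmxP => i j; rewrite [RHS]scaler_sumr.
by apply: eq_bigr => k _; exact: amulZr.
Qed.

Lemma cmx_adjK : involutive cmx_adj.
Proof. by move=> X; apply: cmxP => i j; exact: adjK. Qed.

Lemma cmx_adjD : {morph cmx_adj : X Y / X + Y}.
Proof. by move=> X Y; apply: cmxP => i j; exact: adjD. Qed.

Lemma cmx_adjZ (c : R[i]) X : cmx_adj (c *: X) = conjc c *: cmx_adj X.
Proof. by apply: cmxP => i j; exact: adjZ. Qed.

Lemma cmx_adjM X Y : cmx_adj (cmx_mul X Y) = cmx_mul (cmx_adj Y) (cmx_adj X).
Proof.
apply: cmxP => i j; rewrite /cmx_adj /cmx_mul adj_sum.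
by apply: eq_bigr => k _; exact: adjM.
Qed.

HB.instance Definition _ := Lmodule_isStarAlgebra.Build R cstar_mx
  cmx_mulA cmx_mulDl cmx_mulDr cmx_mulZl cmx_mulZr
  cmx_adjK cmx_adjD cmx_adjZ cmx_adjM.

Lemma cmx_actM X Y xi : cmx_act (cmx_mul X Y) xi = cmx_act X (cmx_act Y xi).
Proof.
apply/funext => i; rewrite /cmx_act /cmx_mul.
under eq_bigr do rewrite amul_suml; rewrite exchange_big /=.
by apply: eq_bigr => k _; rewrite amul_sumr; apply: eq_bigr => l _; rewrite amulA.
Qed.

Lemma cmx_actDl X Y xi : cmx_act (X + Y) xi = cmx_act X xi + cmx_act Y xi.
Proof.
apply/funext => i; transitivity (cmx_act X xi i + cmx_act Y xi i) => //.
by rewrite -big_split; apply: eq_bigr => k _; exact: amulDl.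
Qed.

Lemma cmx_actZl (c : R[i]) X xi : cmx_act (c *: X) xi = c *: cmx_act X xi.
Proof.
apply/funext => i; rewrite [RHS]scaler_sumr.
by apply: eq_bigr => k _; exact: amulZl.
Qed.

Lemma cmx_actZr (c : R[i]) X xi : cmx_act X (c *: xi) = c *: cmx_act X xi.
Proof.
apply/funext => i; rewrite [RHS]scaler_sumr.
by apply: eq_bigr => k _; exact: amulZr.
Qed.

Lemma ip_cmx_act X xi eta : ip (cmx_act (cmx_adj X) xi) eta = ip xi (cmx_act X eta).
Proof.
rewrite /ip /cmx_act; under eq_bigr do rewrite adj_sum amul_suml.
rewrite exchange_big /=; apply: eq_bigr => k _; rewrite amul_sumr.
by apply: eq_bigr => l _; rewrite adjM /cmx_adj adjK amulA.
Qed.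

Definition cmx_norm X : R := sup [set hnorm (cmx_act X xi) | xi in [set xi | hnorm xi <= 1]].

Definition cmx_sum X : R := \sum_i \sum_j rnorm (X i j).

Lemma hnorm_act_le_sum X xi : hnorm (cmx_act X xi) <= cmx_sum X * hnorm xi.
Proof.
apply: le_trans (hnorm_le_sum _) _; rewrite mulr_suml; apply: ler_sum => i _.
apply: le_trans (rnorm_sum _ _) _; rewrite mulr_suml; apply: ler_sum => j _.
apply: le_trans (rnormM _ _) _; rewrite ler_wpM2l ?rnorm_ge0 //.
exact: rnorm_entry_le.
Qed.

Lemma hnorm0 : hnorm (0 : 'I_n -> A) = 0.
Proof. by have := hnormZ 0 (0 : 'I_n -> A); rewrite scale0r normr0 mul0r. Qed.

Lemma cmx_sum_ge0 X : 0 <= cmx_sum X.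
Proof. by apply: sumr_ge0 => i _; apply: sumr_ge0 => j _; exact: rnorm_ge0. Qed.

Lemma cmx_norm_has_sup X :
  has_sup [set hnorm (cmx_act X xi) | xi in [set xi | hnorm xi <= 1]].
Proof.
split; first by exists (hnorm (cmx_act X 0)); exists 0 => //=; rewrite hnorm0.
exists (cmx_sum X) => _ [xi /= xi1 <-].
by apply: le_trans (hnorm_act_le_sum _ _) _; rewrite ler_piMr // cmx_sum_ge0.
Qed.

Lemma cmx_norm_ge0 X : 0 <= cmx_norm X.
Proof.
apply: le_trans (hnorm_ge0 (cmx_act X 0)) _; apply: sup_upper_bound.
  exact: cmx_norm_has_sup.
by exists 0 => //=; rewrite hnorm0.
Qed.

Lemma hnorm_act_le X xi : hnorm (cmx_act X xi) <= cmx_norm X * hnorm xi.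
Proof.
have [xi0|xi0] := eqVneq (hnorm xi) 0.
  by have := hnorm_act_le_sum X xi; rewrite xi0 !mulr0.
have t0 : 0 < hnorm xi by rewrite lt_def xi0 hnorm_ge0.
have nt (zeta : 'I_n -> A) :
    hnorm ((hnorm xi)^-1%:C *: zeta) = (hnorm xi)^-1 * hnorm zeta.
  by rewrite hnormZ normc_def /= expr0n addr0 sqrtr_sqr ger0_norm // invr_ge0 ltW.
rewrite mulrC -ler_pdivrMl // -nt -cmx_actZr; apply: sup_upper_bound.
  exact: cmx_norm_has_sup.
by exists ((hnorm xi)^-1%:C *: xi) => //=; rewrite nt mulVf.
Qed.

Lemma cmx_norm_le X (t : R) : 0 <= t ->
  (forall xi, hnorm (cmx_act X xi) <= t * hnorm xi) -> cmx_norm X <= t.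
Proof.
move=> t0 Xt; apply: ge_sup; first by case: (cmx_norm_has_sup X).
by move=> _ [xi /= xi1 <-]; apply: le_trans (Xt xi) _; rewrite ler_piMr.
Qed.

Lemma cmx_norm_le_sum X : cmx_norm X <= cmx_sum X.
Proof. by apply: cmx_norm_le (cmx_sum_ge0 X) _; exact: hnorm_act_le_sum. Qed.

Lemma cmx_entry_le X i j : rnorm (X i j) <= cmx_norm X.
Proof.
pose xi k : A := if k == j then uone else 0.
have -> : X i j = cmx_act X xi i.
  rewrite /cmx_act (bigD1 j) //= /xi eqxx amul_uone big1 ?addr0 // => k /negPf ->.
  by rewrite amul0r.
apply: le_trans (rnorm_entry_le _ _) _; apply: le_trans (hnorm_act_le _ _) _.
rewrite ler_piMr ?cmx_norm_ge0 //; apply: hnorm_le => //; rewrite /ip (bigD1 j) //=.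
rewrite big1 => [|k /negPf kj]; last by rewrite /xi kj amul0r.
by rewrite /xi eqxx amul_uone adj_uone addr0 expr1n rnorm_uone.
Qed.

Lemma cmx_normD X Y : cmx_norm (X + Y) <= cmx_norm X + cmx_norm Y.
Proof.
apply: cmx_norm_le; first by rewrite addr_ge0 ?cmx_norm_ge0.
move=> xi; rewrite cmx_actDl mulrDl; apply: le_trans (hnormD _ _) _.
by apply: lerD; exact: hnorm_act_le.
Qed.

Lemma cmx_normZ_le (c : R[i]) X : cmx_norm (c *: X) <= complex.Re `|c| * cmx_norm X.
Proof.
apply: cmx_norm_le; first by rewrite mulr_ge0 ?Re_norm_ge0 ?cmx_norm_ge0.
move=> xi; rewrite cmx_actZl hnormZ -mulrA.
by rewrite ler_wpM2l ?Re_norm_ge0 // hnorm_act_le.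
Qed.

Lemma cmx_normZ (c : R[i]) X : cmx_norm (c *: X) = complex.Re `|c| * cmx_norm X.
Proof.
apply/eqP; rewrite eq_le cmx_normZ_le andTb.
have [->|c0] := eqVneq c 0; first by rewrite normr0 /= mul0r cmx_norm_ge0.
have cn : `|c| = (complex.Re `|c|)%:C by rewrite RRe_real // normr_real.
have c1 : 0 < complex.Re `|c| by rewrite -ltcR -cn normr_gt0.
rewrite mulrC -ler_pdivlMr //.
have := cmx_normZ_le c^-1 (c *: X); rewrite scalerA mulVf // scale1r.
by rewrite normfV cn -fmorphV /= mulrC.
Qed.

Lemma cmx_norm_eq0 X : cmx_norm X = 0 -> X = 0.
Proof.
move=> X0; apply: cmxP => i j; apply/rnorm_eq0/eqP.
by rewrite eq_le rnorm_ge0 -X0 cmx_entry_le.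
Qed.

Lemma cmx_normM X Y : cmx_norm (X ** Y) <= cmx_norm X * cmx_norm Y.
Proof.
apply: cmx_norm_le; first by rewrite mulr_ge0 ?cmx_norm_ge0.
move=> xi; rewrite cmx_actM; apply: le_trans (hnorm_act_le _ _) _.
by rewrite -mulrA ler_wpM2l ?cmx_norm_ge0 // hnorm_act_le.
Qed.

Lemma cmx_norm_sq_le X : cmx_norm X ^+ 2 <= cmx_norm (adj X ** X).
Proof.
rewrite -ler_sqrt ?cmx_norm_ge0 // sqrtr_sqr ger0_norm ?cmx_norm_ge0 //.
apply: cmx_norm_le; first exact: sqrtr_ge0.
move=> xi; apply: hnorm_le; first by rewrite mulr_ge0 ?sqrtr_ge0 ?hnorm_ge0.
rewrite exprMn sqr_sqrtr ?cmx_norm_ge0 //.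
rewrite -{1}(cmx_adjK X) ip_cmx_act -cmx_actM.
apply: le_trans (cauchy_schwarz _ _) _; rewrite expr2 mulrA mulrC.
by rewrite ler_wpM2r ?hnorm_ge0 // hnorm_act_le.
Qed.

Lemma cmx_norm_cstar X : cmx_norm (adj X ** X) = cmx_norm X ^+ 2.
Proof.
have adj_le Y : cmx_norm Y <= cmx_norm (adj Y).
  have := le_trans (cmx_norm_sq_le Y) (cmx_normM _ _); rewrite expr2.
  have [->|Y0] := eqVneq (cmx_norm Y) 0; first by rewrite cmx_norm_ge0.
  by rewrite ler_pM2r // lt_def Y0 cmx_norm_ge0.
apply/eqP; rewrite eq_le cmx_norm_sq_le andbT.
apply: le_trans (cmx_normM _ _) _; rewrite expr2 ler_wpM2r ?cmx_norm_ge0 //.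
by rewrite -{2}(adjK X) adj_le.
Qed.

Let cnorm X : R[i] := (cmx_norm X)%:C.

Let cnormD X Y : cnorm (X + Y) <= cnorm X + cnorm Y.
Proof. by rewrite /cnorm -rmorphD lecR cmx_normD. Qed.

Let cnormZ (c : R[i]) X : cnorm (c *: X) = `|c| * cnorm X.
Proof.
have cn : `|c| = (complex.Re `|c|)%:C by rewrite RRe_real // normr_real.
by rewrite /cnorm cmx_normZ rmorphM [in RHS]cn.
Qed.

Let cnorm_eq0 X : cnorm X = 0 -> X = 0.
Proof. by move=> X0; apply: cmx_norm_eq0; apply: complexI. Qed.

HB.instance Definition _ :=
  Lmodule_isNormed.Build R[i] cstar_mx cnormD cnormZ cnorm_eq0.

Lemma cmx_normE X : `|X| = (cmx_norm X)%:C.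
Proof. by []. Qed.

(** The operator norm lies between the largest norm of an entry and the sum of
the norms of the entries, so completeness is inherited from A entrywise. *)
Lemma cmx_complete (F : set_system cstar_mx) : ProperFilter F -> cauchy F -> cvg F.
Proof.
move=> FF /cauchyP Fc.
have part i j : cvg ((fun X : cstar_mx => X i j) @ F).
  apply: cauchy_cvg; apply: cauchy_exP => e e0.
  have [X FX] := Fc e e0; exists (X i j); rewrite /nbhs /=; apply: filterS FX => Y.
  rewrite -!ball_normE /ball_ /=; apply: le_lt_trans.
  have : `|X i j - Y i j| <= (cmx_norm (X - Y))%:C.
    by rewrite normE lecR; exact: (cmx_entry_le (X - Y)).
  by [].
pose L : cstar_mx := fun i j => lim ((fun X : cstar_mx => X i j) @ F).
have LP i j : (fun X : cstar_mx => X i j) @ F --> L i j by exact: part.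
apply/cvg_ex; exists L; apply/cvgrPdist_lt => e e0.
have [e' ee' e'0] := real_gt0 e0.
pose d := e' / (n * n).+1%:R; have d0 : 0 < d by rewrite divr_gt0.
have near_ij i j : \forall X \near F, rnorm (L i j - X i j) < d.
  have /cvgrPdist_lt/(_ d%:C) := LP i j; rewrite ltcR => /(_ d0).
  by apply: filterS => X; rewrite normE ltcR.
have : \forall X \near F, forall i j, rnorm (L i j - X i j) < d.
  by apply: filter_forall => i; apply: filter_forall => j; exact: near_ij.
apply: filterS => X LX; rewrite cmx_normE ee' ltcR.
apply: le_lt_trans (cmx_norm_le_sum _) _.
have : cmx_sum (L - X) <= \sum_(i < n) \sum_(j < n) d.
  by apply: ler_sum => i _; apply: ler_sum => j _; exact/ltW/LX.
move/le_lt_trans; apply; rewrite !sumr_const card_ord -mulrnA -[d *+ _]mulr_natr.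
by rewrite /d mulrAC ltr_pdivrMr // ltr_pM2l // ltr_nat.
Qed.

HB.instance Definition _ := Uniform_isComplete.Build cstar_mx cmx_complete.

Let cnormM X Y : `|X ** Y| <= `|X| * `|Y|.
Proof. by rewrite !cmx_normE -rmorphM lecR cmx_normM. Qed.

Let cnorm_cstar X : `|adj X ** X| = `|X| ^+ 2.
Proof. by rewrite !cmx_normE cmx_norm_cstar rmorphXn. Qed.

HB.instance Definition _ := NormedStar_isCStar.Build R cstar_mx cnormM cnorm_cstar.

Lemma cmx_one_mul : left_id cmx_one (@amul R cstar_mx).
Proof.
move=> X; apply: cmxP => i j; rewrite [LHS](bigD1 i) //= /cmx_one eqxx uone_amul.
by rewrite big1 ?addr0 // => k; rewrite eq_sym => /negPf ->; rewrite amul0l.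
Qed.

Lemma cmx_mul_one : right_id cmx_one (@amul R cstar_mx).
Proof.
move=> X; apply: cmxP => i j; rewrite [LHS](bigD1 j) //= /cmx_one eqxx amul_uone.
by rewrite big1 ?addr0 // => k /negPf ->; rewrite amul0r.
Qed.

Definition ucstar_mx : unital_cstar R := UnitalCStar cmx_one_mul cmx_mul_one.

End CStarMatrices.

(** * Maps determined by their values on a dense set *)

Section Lipschitz.
Context (R : realType).
Implicit Types (A B D : cstarAlgType R).

Definition lipschitz A B (f : A -> B) : Prop :=
  exists2 K : R, 0 <= K & forall x y, rnorm (f x - f y) <= K * rnorm (x - y).

Lemma lipschitz_id A : lipschitz (idfun : A -> A).
Proof. by exists 1 => // x y; rewrite mul1r. Qed.

Lemma lipschitz_comp A B D (g : B -> D) (f : A -> B) :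
  lipschitz g -> lipschitz f -> lipschitz (g \o f).
Proof.
move=> [K K0 gK] [L L0 fL]; exists (K * L); first exact: mulr_ge0.
by move=> x y; apply: le_trans (gK _ _) _; rewrite -mulrA ler_wpM2l.
Qed.

Lemma lipschitz_mull A (a : A) : lipschitz (amul a).
Proof.
exists (rnorm a); first exact: rnorm_ge0.
move=> x y; have -> : a ** x - a ** y = a ** (x - y).
  by rewrite amulDr -[- y]scaleN1r amulZr scaleN1r.
exact: rnormM.
Qed.

Lemma lipschitz_mulr A (a : A) : lipschitz (amul^~ a).
Proof.
exists (rnorm a); first exact: rnorm_ge0.
move=> x y; have -> : x ** a - y ** a = (x - y) ** a.
  by rewrite amulDl -[- y]scaleN1r amulZl scaleN1r.
by rewrite mulrC; exact: rnormM.
Qed.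

Lemma lipschitz_adj A : lipschitz (@adj R A).
Proof. by exists 1 => // x y; rewrite -adjB rnorm_adj mul1r. Qed.

Lemma lipschitz_linear A B (f : {linear A -> B}) (K : R) :
  (forall x, rnorm (f x) <= K * rnorm x) -> lipschitz f.
Proof.
move=> fK; exists `|K|; first exact: normr_ge0.
move=> x y; rewrite -raddfB; apply: le_trans (fK _) _.
by rewrite ler_wpM2r ?rnorm_ge0 // ler_norm.
Qed.

Lemma lipschitz_continuous A B (f : A -> B) : lipschitz f -> continuous f.
Proof.
move=> [K K0 fK] x; apply/cvgrPdist_lt => e e0.
have [e' ee' e'0] := real_gt0 e0.
have K1 : 0 < K + 1 by lra.
have d0 : 0 < (e' / (K + 1))%:C :> R[i] by rewrite ltcR divr_gt0.
have /cvgrPdist_lt/(_ _ d0) : y @[y --> x] --> x by exact: cvg_id.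
apply: filterS => y; rewrite !normE ee' !ltcR ltr_pdivlMr // => xy.
by apply: le_lt_trans (fK _ _) _; have := rnorm_ge0 (x - y); lra.
Qed.

Definition dense_map T A (i : T -> A) : Prop :=
  forall x e, 0 < e -> exists t, rnorm (x - i t) <= e.

Lemma dense_range_map T A (i : T -> A) : dense (range i) -> dense_map i.
Proof.
move=> di x e e0; have [_ [t _ <-] xt] := dense_rnorm di x e0.
by exists t; exact: ltW.
Qed.

Lemma dense_map_comp T A B (q : A -> B) (i : T -> A) : lipschitz q ->
  (forall y, exists x, q x = y) -> dense_map i -> dense_map (q \o i).
Proof.
move=> [K K0 qK] qs di y e e0; have [x <-] := qs y.
have K1 : 0 < K + 1 by lra.
have [|t xt] := di x (e / (K + 1)); first exact: divr_gt0.
exists t; apply: le_trans (qK _ _) _.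
move: xt; rewrite ler_pdivlMr // => xt.
by have := rnorm_ge0 (x - i t); lra.
Qed.

Lemma lipschitz_eq T A B (i : T -> A) (f g : A -> B) : dense_map i ->
  lipschitz f -> lipschitz g -> (forall t, f (i t) = g (i t)) -> f =1 g.
Proof.
move=> di [K K0 fK] [L L0 gL] fg x; apply/eqP; rewrite -subr_eq0; apply/eqP.
apply: (@rnorm_smallM _ _ _ (K + L)) => e e0; have [t xt] := di x e e0.
rewrite -(subrKA (f (i t))) [X in _ + (X - _)]fg.
apply: le_trans (rnormD _ _) _; rewrite mulrDl.
apply: lerD; first by apply: le_trans (fK _ _) _; rewrite ler_wpM2l.
by rewrite rdistC; apply: le_trans (gL _ _) _; rewrite ler_wpM2l.
Qed.

Lemma dense_morphism (A0 : starAlgType R) A B (i : star_hom A0 A) (f : A -> B) :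
  dense_map i -> lipschitz f ->
  (forall a b, f (i (a ** b)) = f (i a) ** f (i b)) ->
  (forall a, f (i (adj a)) = adj (f (i a))) ->
  {morph f : x y / x ** y} /\ {morph f : x / adj x}.
Proof.
move=> di fl fM fadj; split.
  have fMr x b : f (x ** i b) = f x ** f (i b).
    apply: (@lipschitz_eq A0 A B i (f \o amul^~ (i b)) (amul^~ (f (i b)) \o f)) => //.
    - by apply: lipschitz_comp => //; exact: lipschitz_mulr.
    - by apply: lipschitz_comp => //; exact: lipschitz_mulr.
    - by move=> a /=; rewrite -star_homM fM.
  move=> x; apply: (@lipschitz_eq A0 A B i (f \o amul x) (amul (f x) \o f)) => //.
  - by apply: lipschitz_comp => //; exact: lipschitz_mull.
  - by apply: lipschitz_comp => //; exact: lipschitz_mull.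
  - by move=> b /=; exact: fMr.
apply: (@lipschitz_eq A0 A B i (f \o @adj R A) (@adj R B \o f)) => //.
- by apply: lipschitz_comp => //; exact: lipschitz_adj.
- by apply: lipschitz_comp => //; exact: lipschitz_adj.
- by move=> a /=; rewrite -star_hom_adj fadj.
Qed.

Definition is_unit A (e : A) : Prop :=
  left_id e (@amul R A) /\ right_id e (@amul R A).

Lemma dense_is_unit T A (i : T -> A) (e : A) : dense_map i ->
  (forall t, e ** i t = i t) -> (forall t, i t ** e = i t) -> is_unit e.
Proof.
move=> di el er; split.
  by apply: (lipschitz_eq di) => //; [exact: lipschitz_mull|exact: lipschitz_id].
by apply: (lipschitz_eq di) => //; [exact: lipschitz_mulr|exact: lipschitz_id].
Qed.

Lemma surj_is_unit A B (q : star_hom A B) (e : A) :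
  (forall y, exists x, q x = y) -> is_unit e -> is_unit (q e).
Proof.
by move=> qs [el er]; split=> y; have [x <-] := qs y; rewrite -star_homM ?el ?er.
Qed.

Lemma positive_lipschitz A B (eA : A) (eB : B) (S : {linear A -> B}) :
  is_unit eA -> is_unit eB ->
  (forall x, exists y, S (adj x ** x) = adj y ** y) -> lipschitz S.
Proof.
move=> [Al Ar] [Bl Br] Sp.
apply: lipschitz_linear.
exact: (@positive_map_bounded R (UnitalCStar Al Ar) (UnitalCStar Bl Br) S Sp).
Qed.

Lemma star_hom_lipschitz A B (eA : A) (eB : B) (q : star_hom A B) :
  is_unit eA -> is_unit eB -> lipschitz q.
Proof.
move=> hA hB; apply: (positive_lipschitz hA hB) => x.
by exists (q x); rewrite star_homM star_hom_adj.
Qed.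

Lemma cp_map_lipschitz A B (eA : A) (eB : B) (S : cp_map A B) :
  is_unit eA -> is_unit eB -> lipschitz S.
Proof.
move=> hA hB; apply: (positive_lipschitz hA hB) => x.
have : mx_positive (\matrix_(i < 1, j < 1) (adj x ** x)).
  exists (\matrix_(i, j) x); apply/matrixP => i j.
  by rewrite !mxE big_ord1 !mxE.
move/(cp_fun_cp S) => [Y /matrixP/(_ 0 0)]; rewrite !mxE big_ord1 mxE => SY.
by exists (Y 0 0).
Qed.

End Lipschitz.

(** * The system of 2 by 2 matrices attached to a unitary representation *)

(** The (i0, i0) entry of a sum of squares is a sum of squares of n by n matrices
of columns of entries; their sum is a single square because positivity is
available in the C*-algebra of n by n matrices. *)
Lemma entry_completely_positive (R : realType) (A : unital_cstar R) (m : nat) (i0 : 'I_m) :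
  completely_positive (fun X : ucstar_mx A m => X i0 i0 : A).
Proof.
move=> n X [Y ->].
pose W l : ucstar_mx A n := fun k j => Y k j l i0.
have : pos (\sum_l adj (W l) ** W l) by apply: pos_sum => l; exact: pos_adjmul.
move=> /pos_adjmulE[Z WZ]; exists (\matrix_(i, j) Z i j); apply/matrixP => i j.
rewrite !mxE; transitivity ((adj Z ** Z) i j); last first.
  by apply: eq_bigr => k _; rewrite !mxE.
rewrite -WZ !cmx_sumE.
transitivity (\sum_k \sum_l adj (Y k i l i0) ** Y k j l i0); last exact: exchange_big.
by apply: eq_bigr => k _; rewrite mxE.
Qed.

Section TwistedMatrices.
Context (R : realType) (G : groupType) (M : unital_cstar R) (u : G -> M).
Context (u1 : u 1%g = uone).
Context (uM : forall g h, u (g * h)%g = u g ** u h).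
Context (uV : forall g, adj (u g) = u (g^-1)%g).

Let D : unital_cstar R := ucstar_mx M 2.

(** The i-th diagonal entry of diag (u_g, 1). *)
Definition corner_unitary (i : 'I_2) (g : G) : M := if i == 0 then u g else uone.

Lemma corner_unitary1 i : corner_unitary i 1%g = uone.
Proof. by rewrite /corner_unitary u1; case: ifP. Qed.

Lemma corner_unitaryM i g h :
  corner_unitary i (g * h)%g = corner_unitary i g ** corner_unitary i h.
Proof. by rewrite /corner_unitary uM; case: ifP => // _; rewrite uone_amul. Qed.

Lemma corner_unitary_iso i g : adj (corner_unitary i g) ** corner_unitary i g = uone.
Proof.
rewrite /corner_unitary; case: ifP => _; first by rewrite uV -uM mulVg u1.
by rewrite adj_uone uone_amul.
Qed.

Definition twist_fun (g : G) (X : D) : D :=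
  fun i j => corner_unitary i g ** X i j ** adj (corner_unitary j g).

Lemma twist_linear g : linear (twist_fun g).
Proof.
by move=> c X Y; apply: cmxP => i j; rewrite /twist_fun amulDr amulDl amulZr amulZl.
Qed.

HB.instance Definition _ g :=
  GRing.isLinear.Build R[i] D D *:%R (twist_fun g) (twist_linear g).

Lemma twistM g : {morph twist_fun g : X Y / X ** Y}.
Proof.
move=> X Y; apply: cmxP => i j; rewrite /twist_fun.
transitivity (corner_unitary i g ** (\sum_k X i k ** Y k j) **
  adj (corner_unitary j g)) => //; rewrite amul_sumr amul_suml.
apply: eq_bigr => k _; rewrite !amulA; congr (_ ** _ ** _).
by rewrite -(amulA _ (adj _)) corner_unitary_iso amul_uone.
Qed.

Lemma twist_adj g : {morph twist_fun g : X / adj X}.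
Proof.
move=> X; apply: cmxP => i j.
transitivity (adj (corner_unitary j g ** X j i ** adj (corner_unitary i g))) => //.
by rewrite !adjM adjK amulA.
Qed.

Lemma twist1 X : twist_fun 1%g X = X.
Proof.
by apply: cmxP => i j; rewrite /twist_fun !corner_unitary1 adj_uone uone_amul amul_uone.
Qed.

Lemma twist_comp g h X : twist_fun (g * h)%g X = twist_fun g (twist_fun h X).
Proof.
by apply: cmxP => i j; rewrite /twist_fun !corner_unitaryM adjM !amulA.
Qed.

Definition twisted_mx : gcstar R G :=
  @GCStar R G D (fun g => @StarHom R D D (twist_fun g : {linear D -> D})
    (@twistM g) (@twist_adj g)) twist1 twist_comp.

Definition corner_fun (z : Cstar_C R) : D :=
  fun i j => if (i == 0) && (j == 0) then (z : R[i]) *: uone else 0.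

Lemma corner_linear : linear corner_fun.
Proof.
move=> c y z; apply: cmxP => i j.
transitivity (c *: corner_fun y i j + corner_fun z i j) => //.
rewrite /corner_fun; case: ifP => _; last by rewrite scaler0 addr0.
transitivity ((c * (y : R[i]) + (z : R[i])) *: (uone : M)) => //.
by rewrite scalerDl scalerA.
Qed.

HB.instance Definition _ :=
  GRing.isLinear.Build R[i] (Cstar_C R) D *:%R corner_fun corner_linear.

Lemma cornerM : {morph corner_fun : y z / y ** z}.
Proof.
move=> y z; apply: cmxP => i j.
transitivity (\sum_k corner_fun y i k ** corner_fun z k j) => //.
rewrite !big_ord_recl big_ord0 addr0.
rewrite /corner_fun /= !andbT amul0r addr0.
case: (i == 0) => /=; last by rewrite amul0l.
case: (j == 0) => /=; last by rewrite amul0r.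
by rewrite amulZl uone_amul scalerA.
Qed.

Lemma corner_adj : {morph corner_fun : z / adj z}.
Proof.
move=> z; apply: cmxP => i j.
transitivity (adj (corner_fun z j i)) => //; rewrite /corner_fun andbC.
by case: ifP => _; rewrite ?adj0 // adjZ adj_uone.
Qed.

Lemma corner_equivariant :
  @equivariant R G (trivial_action G (Cstar_C R)) twisted_mx corner_fun.
Proof.
move=> g z; apply: cmxP => i j.
transitivity (twist_fun g (corner_fun z) i j) => //; rewrite /twist_fun /corner_fun.
case: ifP => [/andP[/eqP -> /eqP ->]|_]; last by rewrite amul0r amul0l.
rewrite /corner_unitary /= amulZr amul_uone amulZl uV -uM mulgV u1.
by [].
Qed.

Definition corner_ghom : ghom (trivial_action G (Cstar_C R)) twisted_mx :=
  @GHom R G (trivial_action G (Cstar_C R)) twisted_mx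
    (@StarHom R (Cstar_C R) D (corner_fun : {linear Cstar_C R -> D}) cornerM corner_adj)
    corner_equivariant.

Definition entry_fun (X : D) : M := X 1 1.

Lemma entry_linear : linear entry_fun.
Proof. by []. Qed.

HB.instance Definition _ :=
  GRing.isLinear.Build R[i] D M *:%R entry_fun entry_linear.

Lemma entry_equivariant :
  @equivariant R G twisted_mx (trivial_action G M) entry_fun.
Proof.
move=> g X; transitivity (twist_fun g X 1 1) => //; rewrite /twist_fun /corner_unitary.
by rewrite adj_uone uone_amul amul_uone.
Qed.

Definition entry_gcp : gcp_map twisted_mx (trivial_action G M) :=
  @GCpMap R G twisted_mx (trivial_action G M)
    (@CpMap R D M (entry_fun : {linear D -> M}) (@entry_completely_positive R M 2 1))
    entry_equivariant.

Definition matrix_unit (i0 j0 : 'I_2) : D :=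
  fun i j => if (i == i0) && (j == j0) then uone else 0.

(** The action of g sends E_12 to u_g E_12. This product is the value at g of the
convolution of E_21, of z at g, and of E_12. *)
Lemma entry_conj_corner g (z : Cstar_C R) :
  entry_fun (matrix_unit 1 0 ** corner_fun z ** twist_fun g (matrix_unit 0 1)) =
  (z : R[i]) *: u g.
Proof.
transitivity (\sum_k (\sum_l matrix_unit 1 0 1 l ** corner_fun z l k) **
  twist_fun g (matrix_unit 0 1) k 1) => //.
rewrite !big_ord_recl !big_ord0 /twist_fun /matrix_unit /corner_fun /corner_unitary /=.
rewrite !(amul0l, amul0r, addr0) adj_uone !amul_uone uone_amul.
by rewrite amulZl uone_amul.
Qed.

End TwistedMatrices.

(** * Units and density in crossed products *)

Section Dirac.
Context (R : realType) (G : groupType) (A : gcstar R G).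

Lemma dirac1_finsupp (a : A) : (fun s : G => if s == 1%g then a else 0) \in finsupp_pred A.
Proof.
apply/asboolP; apply: sub_finite_set (finite_set1 1%g) => s /=.
by case: ifP => [/eqP|_]; rewrite ?eqxx.
Qed.

Definition dirac1 (a : A) : alg_crossed A := AlgCrossed (dirac1_finsupp a).

Lemma dirac1_mul (a : A) (f : alg_crossed A) t : (dirac1 a ** f) t = a ** f t.
Proof.
transitivity (\sum_(s <- [fset 1%g]%fset)
  dirac1 a s ** act A s (f (s^-1 * t)%g)).
  by apply: convE => s; rewrite inE /= => /negPf ->.
by rewrite big_seq_fset1 /= eqxx act1 invg1 mul1g.
Qed.

Lemma mul_dirac1 (f : alg_crossed A) (a : A) t : (f ** dirac1 a) t = f t ** act A t a.
Proof.
transitivity (\sum_(s \in [set: G]) f s ** act A s (dirac1 a (s^-1 * t)%g)) => //.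
rewrite (fsbigTE [fset t]%fset); last first.
  move=> s; rewrite inE /= => st; case: ifP => [/eqP st1|_].
    by case/eqP: st; rewrite -[s]mulg1 -st1 mulVKg.
  by rewrite raddf0 amul0r.
by rewrite big_seq_fset1 /= mulVg eqxx.
Qed.

Lemma act_is_unit (e : A) g : is_unit e -> act A g e = e.
Proof.
move=> [el er]; rewrite -[LHS]el -{1}[e]act1 -(mulgV g) actM -star_homM er.
by rewrite -actM mulgV act1.
Qed.

Lemma dirac1_is_unit (e : A) : is_unit e ->
  left_id (dirac1 e) (@amul R (alg_crossed A)) /\
  right_id (dirac1 e) (@amul R (alg_crossed A)).
Proof.
move=> he; have [el er] := he.
split=> f; apply: alg_crossedP => t; first by rewrite dirac1_mul el.
by rewrite mul_dirac1 act_is_unit.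
Qed.

Lemma emb_is_unit (F : completion_functor R G) (e : A) : is_unit e ->
  is_unit (emb F A (dirac1 e)).
Proof.
move=> /dirac1_is_unit[el er].
apply: (dense_is_unit (dense_range_map (@emb_dense _ _ F A))) => f.
  by rewrite -star_homM el.
by rewrite -star_homM er.
Qed.

Context (Fmax : maximal_crossed_product R G) (Fred : reduced_crossed_product R G).
Context (mu : crossed_product_functor Fmax Fred).

Lemma mu_q_surjective (y : mu A) : exists x, mu_q mu A x = y.
Proof. by have [x _ <-] := @mu_q_surj _ _ _ _ mu A y I; exists x. Qed.

Lemma mu_emb_is_unit (e : A) : is_unit e -> is_unit (mu_emb mu A (dirac1 e)).
Proof. by move=> he; apply: surj_is_unit mu_q_surjective _; exact: emb_is_unit. Qed.

Lemma mu_emb_dense (e : A) : is_unit e -> dense_map (mu_emb mu A).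
Proof.
move=> he; apply: (@dense_map_comp _ _ _ _ (mu_q mu A)) mu_q_surjective _.
  exact: star_hom_lipschitz (emb_is_unit Fmax he) (mu_emb_is_unit he).
by apply: dense_range_map; exact: emb_dense.
Qed.

End Dirac.

Lemma mu_emb_map (R : realType) (G : groupType) (Fmax : maximal_crossed_product R G)
    (Fred : reduced_crossed_product R G) (mu : crossed_product_functor Fmax Fred)
    (A B : gcstar R G) (phi : ghom A B) (f : alg_crossed A) :
  fmap mu phi (mu_emb mu A f) = mu_emb mu B (alg_crossed_map phi f).
Proof. by rewrite /mu_emb /= -natural emb_map. Qed.

(** * The coproduct on the group algebra *)

Section GroupAlgebra.
Context (R : realType) (G : groupType).

Lemma Cstar_C_is_unit : is_unit (1 : Cstar_C R).
Proof. by split=> x; [exact: mul1r|exact: mulr1]. Qed.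

Lemma group_elt1 : group_elt R (1%g : G) =
  dirac1 (A := trivial_action G (Cstar_C R)) (1 : Cstar_C R).
Proof. by apply: alg_crossedP => t /=; case: eqP. Qed.

Lemma group_eltM (g h : G) : group_elt R (g * h)%g = group_elt R g ** group_elt R h.
Proof.
apply: alg_crossedP => t.
transitivity (\sum_(s <- [fset g]%fset)
  group_elt R g s ** act (trivial_action G (Cstar_C R)) s (group_elt R h (s^-1 * t)%g)).
  rewrite big_seq_fset1 /= eqxx.
  rewrite (_ : (t == g * h)%g = (g^-1 * t == h)%g); first by rewrite [RHS]mul1r.
  by apply/eqP/eqP => [->|<-]; rewrite ?mulKg ?mulVKg.
by apply/esym/convE => s; rewrite inE /= => /negPf ->.
Qed.

Lemma group_elt_adj (g : G) : adj (group_elt R g) = group_elt R (g^-1)%g.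
Proof.
apply: alg_crossedP => t.
transitivity (conjc ((t^-1 == g)%g%:R : R[i])) => //.
rewrite conjc_nat /=; congr ((_ : bool)%:R).
by apply/eqP/eqP => [<-|->]; rewrite invgK.
Qed.

Section Twist.
Context (M : unital_cstar R) (u : G -> M).
Context (uM : forall g h, u (g * h)%g = u g ** u h).
Context (uV : forall g, adj (u g) = u (g^-1)%g).

Lemma rep_twist_finsupp (f : group_algebra R G) :
  (fun s => (f s : R[i]) *: u s) \in finsupp_pred (trivial_action G M).
Proof.
apply/asboolP; apply: sub_finite_set (alg_crossed_supp f) => s /=.
by apply: contraNN => /eqP ->; rewrite scale0r.
Qed.

(** For the universal representation u this is the coproduct, the tensor u_g (x) g
being the function on G with value u_g at g. *)
Definition rep_twist (f : group_algebra R G) : alg_crossed (trivial_action G M) :=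
  AlgCrossed (rep_twist_finsupp f).

Lemma rep_twistM f g : rep_twist (f ** g) = rep_twist f ** rep_twist g.
Proof.
apply: alg_crossedP => t.
transitivity (\sum_(s <- supp f) ((f s : R[i]) *: u s) **
    ((g (s^-1 * t)%g : R[i]) *: u (s^-1 * t)%g)); last first.
  apply/esym; apply: (@convE _ _ _ (supp f) (rep_twist f) (rep_twist g) t) => s /suppPn fs.
  by rewrite /= fs scale0r.
have -> : rep_twist (f ** g) t =
    ((\sum_(s <- supp f) (f s : R[i]) * (g (s^-1 * t)%g : R[i])) : R[i]) *: u t.
  congr (_ *: _).
  by apply: (@convE _ _ _ (supp f) f g t) => s; exact: suppPn.
rewrite scaler_suml; apply: eq_bigr => s _.
by rewrite amulZl amulZr scalerA -uM mulVKg.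
Qed.

Lemma rep_twist_adj f : rep_twist (adj f) = adj (rep_twist f).
Proof.
apply: alg_crossedP => t.
transitivity (adj ((f t^-1%g : R[i]) *: u t^-1%g)) => //.
by rewrite adjZ uV invgK.
Qed.

End Twist.

Context (Fmax : maximal_crossed_product R G) (Fred : reduced_crossed_product R G).
Context (mu : crossed_product_functor Fmax Fred).

Lemma Cstar_max_is_unit :
  is_unit (emb Fmax (trivial_action G (Cstar_C R)) (group_elt R (1%g : G))).
Proof. by rewrite group_elt1; apply: emb_is_unit; exact: Cstar_C_is_unit. Qed.

Definition ucstar_max : unital_cstar R :=
  UnitalCStar (proj1 Cstar_max_is_unit) (proj2 Cstar_max_is_unit).

Definition universal_rep (g : G) : ucstar_max := emb Fmax _ (group_elt R g).

Lemma coproductE f :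
  coproduct mu f = mu_emb mu (trivial_action G ucstar_max) (rep_twist universal_rep f).
Proof.
rewrite /coproduct (fsbigTE (supp f)); last first.
  by move=> g /suppPn ->; rewrite scale0r.
under eq_bigr do rewrite -linearZ.
rewrite -raddf_sum; congr (mu_emb _ _ _); apply: alg_crossedP => t.
transitivity (\sum_(g <- supp f) (f g : R[i]) *: (((t == g)%:R : R[i]) *: universal_rep g)).
  by elim/big_rec2: _ => // g x y _ <-.
have [tf|tf] := boolP (t \in supp f); last first.
  rewrite big_seq big1 => [|g gf]; first by rewrite /= (suppPn tf) scale0r.
  case: eqP => [tg|_]; last by rewrite scale0r scaler0.
  by rewrite -tg (negPf tf) in gf.
rewrite (big_fsetD1 t) //= eqxx scale1r big_seq big1 ?addr0 // => g.
by rewrite !inE eq_sym => /andP[/negPf -> _]; rewrite scale0r scaler0.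
Qed.

End GroupAlgebra.

(** * Twisting by a unitary representation *)

Section MuTwist.
Context (R : realType) (G : groupType) (M : unital_cstar R) (u : G -> M).
Context (u1 : u 1%g = uone).
Context (uM : forall g h, u (g * h)%g = u g ** u h).
Context (uV : forall g, adj (u g) = u (g^-1)%g).
Context (Fmax : maximal_crossed_product R G) (Fred : reduced_crossed_product R G).
Context (mu : crossed_product_functor Fmax Fred).

Let C := trivial_action G (Cstar_C R).
Let D := twisted_mx u1 uM uV.
Let T := trivial_action G M.

Lemma entry_twist (f : group_algebra R G) :
  alg_crossed_map (entry_gcp u1 uM uV)
    (dirac1 (A := D) (matrix_unit M 1 0) **
     alg_crossed_map (corner_ghom u1 uM uV) f **
     dirac1 (A := D) (matrix_unit M 0 1)) = rep_twist u f.
Proof.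
apply: alg_crossedP => t; rewrite -[RHS]entry_conj_corner.
transitivity (entry_fun
  ((dirac1 (A := D) (matrix_unit M 1 0) ** alg_crossed_map (corner_ghom u1 uM uV) f **
    dirac1 (A := D) (matrix_unit M 0 1)) t)) => //.
by rewrite mul_dirac1 dirac1_mul.
Qed.

Lemma mu_twist : correspondence_functor mu ->
  exists2 Delta : star_hom (Cstar_mu mu) (mu_tensor mu M), lipschitz Delta &
    forall f : group_algebra R G, Delta (mu_emb mu C f) = mu_emb mu T (rep_twist u f).
Proof.
move=> [cpmap [cpmapE _ _]].
have hM : is_unit (uone : M) by split; [exact: uone_amul|exact: amul_uone].
have hD : is_unit (uone : ucstar_mx M 2) by split; [exact: uone_amul|exact: amul_uone].
have hmuC := mu_emb_is_unit mu (A := C) (Cstar_C_is_unit R).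
have hmuD := mu_emb_is_unit mu (A := D) hD.
have hmuT := mu_emb_is_unit mu (A := T) hM.
pose v := mu_emb mu D (dirac1 (A := D) (matrix_unit M 1 0)).
pose w := mu_emb mu D (dirac1 (A := D) (matrix_unit M 0 1)).
pose kappa := fmap mu (corner_ghom u1 uM uV); pose S := cpmap _ _ (entry_gcp u1 uM uV).
pose Delta (x : Cstar_mu mu) : mu_tensor mu M := S (v ** kappa x ** w).
have Delta_linear : linear Delta.
  move=> c x y; rewrite /Delta -linearP; congr (S _).
  by rewrite linearP amulDr amulDl amulZr amulZl.
have Delta_lip : lipschitz Delta.
  apply: (@lipschitz_comp _ _ _ _ S); first exact: cp_map_lipschitz hmuD hmuT.
  apply: (@lipschitz_comp _ _ _ _ (amul^~ w)); first exact: lipschitz_mulr.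
  apply: (@lipschitz_comp _ _ _ _ (amul v)); first exact: lipschitz_mull.
  exact: star_hom_lipschitz hmuC hmuD.
have DeltaE f : Delta (mu_emb mu C f) = mu_emb mu T (rep_twist u f).
  by rewrite /Delta /kappa mu_emb_map -!star_homM /S cpmapE entry_twist.
have [DeltaM Delta_adj] : {morph Delta : x y / x ** y} /\ {morph Delta : x / adj x}.
  apply: (dense_morphism (i := mu_emb mu C)) => //.
  - exact: (@mu_emb_dense R G C Fmax Fred mu _ (Cstar_C_is_unit R)).
  - by move=> a b; rewrite !DeltaE rep_twistM // star_homM.
  - by move=> a; rewrite !DeltaE rep_twist_adj // star_hom_adj.
pose Delta_lin : {linear Cstar_mu mu -> mu_tensor mu M} :=
  HB.pack Delta (GRing.isLinear.Build _ _ _ _ Delta Delta_linear).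
by exists (@StarHom R _ _ Delta_lin DeltaM Delta_adj).
Qed.

End MuTwist.

Theorem theorem3 (R : realType) (G : groupType)
    (Fmax : maximal_crossed_product R G) (Fred : reduced_crossed_product R G)
    (mu : crossed_product_functor Fmax Fred) (hmu : correspondence_functor mu) :
  exists Delta : star_hom (Cstar_mu mu) (mu_tensor mu (Cstar_max Fmax)),
    continuous Delta /\
    forall f : group_algebra R G,
      Delta (mu_emb mu (trivial_action G (Cstar_C R)) f) = coproduct mu f.
Proof.
pose u := universal_rep Fmax.
have uM g h : u (g * h)%g = u g ** u h by rewrite /u /universal_rep group_eltM star_homM.
have uV g : adj (u g) = u (g^-1)%g.
  by rewrite /u /universal_rep -group_elt_adj star_hom_adj.
have [Delta Delta_lip DeltaE] := mu_twist (u := u) erefl uM uV hmu.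
exists Delta; split; first exact: lipschitz_continuous.
by move=> f; rewrite DeltaE -coproductE.
Qed.
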